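(* Let $S\subseteq(0;1)$ be an uncountable analytic set. Then $\{K\in\mathbf{K}:\operatorname{ran}\mathcal{D}_K=\{0,1\}\cup S\}$ is a $\boldsymbol{\Pi}^1_2$-complete subset of $\mathbf{K}$. In particular $\{K\in\mathbf{K}:\operatorname{ran}\mathcal{D}_K=[0;1]\}$ is $\boldsymbol{\Pi}^1_2$-complete.
   Context: $2^{\omega}$ is the Cantor space; $N_s=\{x\in 2^\omega:s\subset x\}$ for finite binary $s$; $\mu$ is the coin-tossing measure with $\mu(N_s)=2^{-\mathrm{lh}(s)}$. For measurable $A$ and $z\in2^\omega$, $\mathcal{D}_A(z)=\lim_{n}\mu(A\cap N_{z\restriction n})/\mu(N_{z\restriction n})$ when the limit exists; $\operatorname{ran}\mathcal{D}_A$ is the set of values attained where defined. $\mathbf{K}$ is the space of all compact subsets of $2^\omega$ with the Vietoris topology (a Polish space). For a boldface pointclass $\boldsymbol{\Gamma}$, a set $A\subseteq X$ ($X$ Polish) is $\boldsymbol{\Gamma}$-complete if $A\in\boldsymbol{\Gamma}(X)$ and for every zero-dimensional Polish space $Z$ and every $B\in\boldsymbol{\Gamma}(Z)$ there is a continuous $f:Z\to X$ with $B=f^{-1}(A)$. *)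

(* Defs.v *)
From HB Require Import structures.
From mathcomp Require Import all_boot all_order all_algebra.
From mathcomp Require Import all_classical all_reals all_analysis.
Set Implicit Arguments. Unset Strict Implicit. Unset Printing Implicit Defensive.
Import Order.TTheory GRing.Theory Num.Theory.
Import numFieldNormedType.Exports.
Local Open Scope classical_set_scope.
Local Open Scope ring_scope.

Definition cyl (s : seq bool) : set cantor_space :=
  [set x | forall i, (i < size s)%N -> x i = nth false s i].

Definition restr (z : cantor_space) (n : nat) : seq bool := mkseq z n.

(* The coin-tossing measure, given as the (outer) measure obtained from the
   premeasure mu(N_s) = 2^{-lh(s)} by countable covers with basic sets.
   On Borel sets (in particular on compact sets) this is the coin-tossing
   measure. *)
Definition coin_mu (R : realType) (A : set cantor_space) : \bar R :=
  ereal_inf [set v : \bar R | exists s : nat -> seq bool,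
    A `<=` \bigcup_n cyl (s n) /\
    v = (\sum_(0 <= n <oo) (((2%:R : R) ^- size (s n))%:E))%E].

(* mu(A ∩ N_{z|n}) / mu(N_{z|n}), with mu(N_{z|n}) = 2^{-n} *)
Definition density_seq (R : realType) (A : set cantor_space)
    (z : cantor_space) (n : nat) : R :=
  fine (coin_mu R (A `&` cyl (restr z n))) / ((2%:R : R) ^- n).

Definition density_at (R : realType) (A : set cantor_space)
    (z : cantor_space) (r : R) : Prop :=
  density_seq R A z n @[n --> \oo] --> r.

Definition density_range (R : realType) (A : set cantor_space) : set R :=
  [set r | exists z, density_at A z r].

Definition hyperK : Type := {A : set cantor_space | compact A}.

HB.instance Definition _ := gen_eqMixin hyperK.
HB.instance Definition _ := gen_choiceMixin hyperK.

Definition vietoris_subbase (p : set cantor_space * bool) : set hyperK :=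
  if p.2 then [set K | proj1_sig K `<=` p.1]
  else [set K | proj1_sig K `&` p.1 !=set0].

HB.instance Definition _ :=
  isSubBaseTopological.Build hyperK
    [set p : set cantor_space * bool | open p.1] vietoris_subbase.

Definition polish (R : realType) (T : topologicalType) : Prop :=
  exists d : T -> T -> R,
    (forall x y, 0 <= d x y) /\
        (forall x y, d x y = 0 <-> x = y) /\
        (forall x y, d x y = d y x) /\
        (forall x y z, d x z <= d x y + d y z) /\
        (forall A : set T, open A <->
           (forall x, A x -> exists2 e : R, 0 < e & [set y | d x y < e] `<=` A)) /\
        (forall u : nat -> T,
           (forall e : R, 0 < e -> exists N, forall m n, (N <= m)%N -> (N <= n)%N ->
              d (u m) (u n) < e) ->
           exists l : T, u n @[n --> \oo] --> l) /\
        (exists D : set T, countable D /\ closure D = setT).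

Definition zero_dim (T : topologicalType) : Prop :=
  forall (x : T) (U : set T), open U -> U x ->
    exists V : set T, [/\ clopen V, V x & V `<=` U].

Definition baire : Type := prod_topology (fun _ : nat => nat).
HB.instance Definition _ := Topological.on baire.

Definition Sigma11 (X : topologicalType) (A : set X) : Prop :=
  exists C : set (X * baire), closed C /\ A = fst @` C.

Definition Pi11 (X : topologicalType) (A : set X) : Prop := Sigma11 (~` A).

Definition Sigma12 (X : topologicalType) (A : set X) : Prop :=
  exists C : set (X * baire), Pi11 C /\ A = fst @` C.

Definition Pi12 (X : topologicalType) (A : set X) : Prop := Sigma12 (~` A).

Definition Pi12_complete (R : realType) (X : topologicalType) (A : set X) : Prop :=
  Pi12 A /\
  forall (Z : topologicalType), polish R Z -> zero_dim Z ->
    forall B : set Z, Pi12 B ->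
      exists f : Z -> X, continuous f /\ B = f @^-1` A.

(* Main.v *)
(** For every set [T] of finite sequences of naturals there is a compact [K_T],
    depending continuously on [T], whose density range is [{0,1}] together with
    the reals [phi w], for [w] an infinite branch of [T]; here the binary digits
    of [phi w] are the parities of the entries of [w].  [K_T] is described by its
    local densities, produced by an automaton reading a point of the Cantor
    space.  Below the node of [s], along [0^k], the density oscillates around the
    centre of the dyadic interval coded by [s] with amplitude a quarter of its
    length, so it has no limit there; after [0^(2n) 1] the density is exactly the
    centre of the interval coded by [s n], and one passes to the node of [s n]
    if [s n] is in [T].  Every other exit leads to a set with an arbitrary
    prescribed density none of whose points has density in (0,1).  As almost
    every point leaves the nodes, these local densities are those of a set.

    Hardness: [S] contains an injective continuous image [P] of the Cantor space,
    and a Pi12 condition "for all y, D(z,y)" with D analytic is coded by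
    [A_z] = (S minus P) together with the codes in P of the y such that D(z,y).
    The reals of [A_z] are the [phi w] for [w] a branch of a tree that varies
    continuously with [z], since [Z] is zero-dimensional.

    Upper bound: the relation "K has density r at z" is both analytic and
    coanalytic. *)
Require Import Defs.
From HB Require Import structures.
From mathcomp Require Import all_boot all_order all_algebra.
From mathcomp Require Import all_classical all_reals all_analysis.
From mathcomp Require Import ring lra zify.
Set Implicit Arguments. Unset Strict Implicit. Unset Printing Implicit Defensive.
Import Order.TTheory GRing.Theory Num.Theory.
Import numFieldNormedType.Exports.
Local Open Scope classical_set_scope.
Local Open Scope ring_scope.

(** * Analytic sets in arbitrary topological spaces *)

Section Sequences.
Variable V : discreteTopologicalType.
Implicit Types f : prod_topology (fun _ : nat => V).

Lemma near_coord f i : \forall g \near f, g i = f i.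
Proof.
have H := @proj_continuous nat (fun _ => V) i f.
have /H : nbhs (proj i f) [set f i] by exact: discrete_set1.
by [].
Qed.

(** Otherwise points agreeing with [f] on longer and longer prefixes would stay outside [U] while
    converging to [f]. *)
Lemma nbhs_prefix f U : nbhs f U ->
  exists n, forall g : prod_topology (fun _ : nat => V), (forall i, (i < n)%N -> g i = f i) -> U g.
Proof.
move=> fU; apply: contrapT => /forallNP H.
have H' n : exists g : prod_topology (fun _ : nat => V), (forall i, (i < n)%N -> g i = f i) /\ ~ U g.
  by have /existsNP[g /not_implyP[? ?]] := H n; exists g.
have [g Hg] := choice H'.
have : g @ \oo --> f.
  apply/cvg_sup => N W [W' [[W''] oW <-] WfN WU].
  apply: (filterS WU); rewrite nbhs_simpl; exists N.+1 => // i /= Ni.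
  by rewrite /preimage /= (Hg i).1.
move=> /(_ U fU) [N _ /(_ N (leqnn N))]; exact: (Hg N).2.
Qed.

Lemma near_prefix f n : \forall g \near f, forall i, (i < n)%N -> g i = f i.
Proof.
have FF : Filter (nbhs f) := nbhs_filter f.
elim: n => [|n IH]; first by near=> g.
near=> g => i; rewrite ltnS leq_eqVlt => /predU1P[->|]; last by move: i; near: g.
by near: g; exact: near_coord.
Unshelve. all: by end_near. Qed.

Lemma continuous_coord (X : topologicalType) (h : X -> prod_topology (fun _ : nat => V)) :
  (forall i x, \forall y \near x, h y i = h x i) -> continuous h.
Proof.
move=> H x U /nbhs_prefix[n Hn].
have : \forall y \near x, forall i, (i < n)%N -> h y i = h x i.
  elim: n {Hn} => [|n IH]; first by near=> y.
  near=> y => i; rewrite ltnS leq_eqVlt => /predU1P[->|]; last by move: i; near: y.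
  by near: y; exact: H.
by apply: filterS => y /Hn.
Unshelve. all: by end_near. Qed.
End Sequences.

Lemma near_bits (x : cantor_space) n : \forall y \near x, y n = x n.
Proof. exact: (@near_coord bool). Qed.
Lemma near_digit (x : baire) n : \forall y \near x, y n = x n.
Proof. exact: (@near_coord nat). Qed.

Section Sigma11Closure.
Variable X : topologicalType.
Implicit Types A B : set X.

Lemma cont_pair (Y U W: topologicalType) (f : Y -> U) (g : Y -> W) :
  continuous f -> continuous g -> continuous (fun x => (f x, g x)).
Proof. by move=> cf cg x; apply: cvg_pair; [exact: cf|exact: cg]. Qed.

Lemma cont_fst (U W : topologicalType) : continuous (@fst U W).
Proof. move=> x; exact: cvg_fst. Qed.
Lemma cont_snd (U W : topologicalType) : continuous (@snd U W).
Proof. move=> x; exact: cvg_snd. Qed.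

Lemma cont_comp (U W Y : topologicalType) (f : W -> Y) (g : U -> W) :
  continuous f -> continuous g -> continuous (fun x => f (g x)).
Proof. move=> cf cg x; apply: (@continuous_comp _ _ _ g f); [exact: cg|exact: cf]. Qed.

Lemma closed_pre (U W : topologicalType) (f : U -> W) (C : set W) :
  continuous f -> closed C -> closed (f @^-1` C).
Proof. by move=> cf; apply: closed_comp => x _; exact: cf. Qed.

Definition reindex (g : nat -> nat) (y : baire) : baire := fun i => y (g i).

Lemma cont_reindex g : continuous (reindex g).
Proof. by apply: (@continuous_coord nat) => i x; exact: near_digit. Qed.

Lemma closed_Sigma11 A : closed A -> Sigma11 A.
Proof.
move=> cA; exists (fst @^-1` A); split; first exact: closed_pre (@cont_fst _ _) cA.
by rewrite eqEsubset; split=> [x Ax|x [[x' y] /= ? <-]] //; exists (x, fun=> 0%N).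
Qed.

(* the first digit names the index, the remaining ones the witness *)
Lemma bigcup_Sigma11 (I : countType) (A : I -> set X) :
  (forall i, Sigma11 (A i)) -> Sigma11 (\bigcup_i A i).
Proof.
move=> /choice[C HC].
pose F i := [set p : X * baire | p.2 0%N <> pickle i] `|`
   ((fun p : X * baire => (p.1, reindex S p.2)) @^-1` C i).
pose G := [set p : X * baire | exists i : I, p.2 0%N = pickle i].
have cl0 (P : nat -> Prop) : closed [set p : X * baire | P (p.2 0%N)].
  rewrite -[X in closed X]setCK; apply: open_closedC.
  rewrite openE => -[x y] /= nP.
  have : \forall p \near (x, y), p.2 0%N = y 0%N.
    by have /(@cont_snd X baire (x, y)) := near_digit y 0.
  by apply: filterS => p /= ->.
exists (G `&` \bigcap_i F i); split.
  apply: closedI; first exact: (cl0 (fun n => exists i : I, n = pickle i)).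
  apply: closed_bigI => i _; apply: closedU; first exact: (cl0 (fun n => n <> pickle i)).
  apply: closed_pre; last exact: (HC i).1.
  apply: cont_pair; first exact: cont_fst.
  by apply: cont_comp; [exact: cont_reindex|exact: cont_snd].
rewrite eqEsubset; split=> [x [i _]|x [[x' y] [[i /= yi] Fy] <-]].
  rewrite (HC i).2 => -[[x' y] /= Cxy <-].
  exists (x', (fun n => if n is m.+1 then y m else pickle i) : baire) => //=; split.
    by exists i.
  move=> j _; have [->|ji] := eqVneq j i; [right|left].
    by rewrite /= (_ : reindex S _ = y).
  by move=> /= /(pcan_inj pickleK) /esym; exact/eqP.
exists i => //; rewrite (HC i).2; exists (x', reindex S y) => //.
by have [//|] := Fy i Logic.I.
Qed.

(** One witness packs all the others: its digits at the codes of the pairs [(i, n)] form the witness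
    for index [i]. *)
Lemma bigcap_Sigma11 (I : countType) (A : I -> set X) :
  (forall i, Sigma11 (A i)) -> Sigma11 (\bigcap_i A i).
Proof.
move=> /choice[C HC].
pose s (i : I) := reindex (fun n => pickle (i, n)).
exists (\bigcap_i ((fun p : X * baire => (p.1, s i p.2)) @^-1` C i)); split.
  apply: closed_bigI => i _; apply: closed_pre; last exact: (HC i).1.
  apply: cont_pair; first exact: cont_fst.
  by apply: cont_comp; [exact: cont_reindex|exact: cont_snd].
rewrite eqEsubset; split=> [x Ax|x [[x' y] Cy <-] i _]; last first.
  by rewrite (HC i).2; exists (x', s i y) => //; exact: Cy.
have /choice[y Hy] i : exists y : baire, C i (x, y).
  by have := Ax i Logic.I; rewrite (HC i).2 => -[[x' y] ? /= <-]; exists y.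
pose y' : baire := fun n => oapp (fun p : I * nat => y p.1 p.2) 0%N (unpickle n).
exists (x, y') => // i _.
rewrite /preimage /= (_ : s i y' = y i); first exact: Hy.
by apply/funext => n; rewrite /s /reindex /y' pickleK.
Qed.

Lemma setU_Sigma11 A B : Sigma11 A -> Sigma11 B -> Sigma11 (A `|` B).
Proof.
move=> sA sB; rewrite -bigcup2E.
rewrite (_ : \bigcup_i _ = \bigcup_(i : bool) (if i then A else B)).
  by apply: bigcup_Sigma11 => -[].
rewrite bigcup2E eqEsubset; split=> [x [?|?]|x [[] _]]; [by exists true|by exists false|by left|by right].
Qed.

Lemma setI_Sigma11 A B : Sigma11 A -> Sigma11 B -> Sigma11 (A `&` B).
Proof.
move=> sA sB.
rewrite (_ : _ `&` _ = \bigcap_(i : bool) (if i then A else B)).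
  by apply: bigcap_Sigma11 => -[].
by rewrite eqEsubset; split=> [x [? ?] [] //|x H]; split; [exact: (H true)|exact: (H false)].
Qed.

Lemma preimage_Sigma11 (Y : topologicalType) (f : X -> Y) (B : set Y) :
  continuous f -> Sigma11 B -> Sigma11 (f @^-1` B).
Proof.
move=> cf [C [cC ->]].
exists ((fun p : X * baire => (f p.1, p.2)) @^-1` C); split.
  apply: closed_pre => //; apply: cont_pair; last exact: cont_snd.
  by apply: cont_comp => //; exact: cont_fst.
rewrite eqEsubset; split=> [x [[y w] Cyw /= ?]|x [[x' w] Cw <-]]; last by exists (f x', w).
by exists (x, w) => //=; subst.
Qed.

(** The two existential witnesses are merged into one, on the even and the odd positions. *)
Lemma proj_Sigma11 (D : set (X * baire)) : Sigma11 D -> Sigma11 (fst @` D).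
Proof.
move=> [C [cC ->]].
pose h (p : X * baire) := ((p.1, reindex double p.2), reindex (fun n => n.*2.+1) p.2).
exists (h @^-1` C); split.
  apply: closed_pre => //; apply: cont_pair; last first.
    by apply: cont_comp; [exact: cont_reindex|exact: cont_snd].
  apply: cont_pair; first exact: cont_fst.
  by apply: cont_comp; [exact: cont_reindex|exact: cont_snd].
rewrite eqEsubset; split=> [x [[x' y] [[p w] Cw /= Ep] <-]|x [[x' y] Cy <-]]; last first.
  by exists (x', reindex double y) => //; exists (h (x', y)).
exists (x', (fun n => if odd n then w n./2 else y n./2) : baire) => //.
rewrite /preimage /h /=; subst p.
rewrite (_ : reindex double _ = y); last first.
  by apply/funext => n; rewrite /reindex odd_double doubleK.
rewrite (_ : reindex _ _ = w)//.
by apply/funext => n; rewrite /reindex /= odd_double /= uphalf_double.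
Qed.
End Sigma11Closure.

(** * Sets that are both analytic and coanalytic *)

Definition Delta11 (X : topologicalType) (A : set X) := Sigma11 A /\ Sigma11 (~` A).

Section Delta11Closure.
Variable X : topologicalType.
Implicit Types A B : set X.

Lemma clopen_Delta11 A : clopen A -> Delta11 A.
Proof. by move=> [oA cA]; split; apply: closed_Sigma11 => //; exact: open_closedC. Qed.

Lemma setC_Delta11 A : Delta11 A -> Delta11 (~` A).
Proof. by move=> [? ?]; split; rewrite ?setCK. Qed.

Lemma bigcup_Delta11 (I : countType) (A : I -> set X) :
  (forall i, Delta11 (A i)) -> Delta11 (\bigcup_i A i).
Proof.
move=> H; split; first by apply: bigcup_Sigma11 => i; exact: (H i).1.
by rewrite setC_bigcup; apply: bigcap_Sigma11 => i; exact: (H i).2.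
Qed.

Lemma bigcap_Delta11 (I : countType) (A : I -> set X) :
  (forall i, Delta11 (A i)) -> Delta11 (\bigcap_i A i).
Proof.
move=> H; split; first by apply: bigcap_Sigma11 => i; exact: (H i).1.
by rewrite setC_bigcap; apply: bigcup_Sigma11 => i; exact: (H i).2.
Qed.

Lemma setU_Delta11 A B : Delta11 A -> Delta11 B -> Delta11 (A `|` B).
Proof.
move=> [sA cA] [sB cB]; split; first exact: setU_Sigma11.
by rewrite setCU; exact: setI_Sigma11.
Qed.

Lemma setI_Delta11 A B : Delta11 A -> Delta11 B -> Delta11 (A `&` B).
Proof.
move=> [sA cA] [sB cB]; split; first exact: setI_Sigma11.
by rewrite setCI; exact: setU_Sigma11.
Qed.

Lemma cst_Delta11 (P : Prop) : Delta11 [set _ : X | P].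
Proof.
have [p|np] := pselect P.
  rewrite (_ : [set _ | _] = setT); first exact/clopen_Delta11/clopenT.
  by rewrite eqEsubset; split.
rewrite (_ : [set _ | _] = set0); first exact/clopen_Delta11/clopen0.
by rewrite eqEsubset; split.
Qed.

Lemma preimage_Delta11 (Y : topologicalType) (f : X -> Y) (B : set Y) :
  continuous f -> Delta11 B -> Delta11 (f @^-1` B).
Proof.
move=> cf [sB cB]; split; first exact: preimage_Sigma11.
exact: (preimage_Sigma11 cf cB).
Qed.
End Delta11Closure.

(** [Sigma11] starts from closed sets, so the open complement is split into countably many closed
    sets: in the n-th one the cylinder of the first [n] digits misses [C]. *)
Lemma closed_baire_Delta11 (C : set baire) : closed C -> Delta11 C.
Proof.
move=> cC; split; first exact: closed_Sigma11.
rewrite (_ : ~` C = \bigcup_(n : nat) [set w : baire |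
   forall w' : baire, (forall i, (i < n)%N -> w' i = w i) -> ~ C w']); last first.
  rewrite eqEsubset; split=> [w nCw|w [n _ Hn]]; last exact: Hn.
  have /(@nbhs_prefix nat)[n Hn] : nbhs (w : baire) (~` C).
    by apply: open_nbhs_nbhs; split => //; exact: closed_openC.
  by exists n.
apply: bigcup_Sigma11 => n; apply: closed_Sigma11.
rewrite -[X in closed X]setCK; apply: open_closedC; rewrite openE => w /= H.
have FF : Filter (nbhs w) := nbhs_filter w.
rewrite /interior; near=> v; contra: H => H w' w'w; apply: H => i ni.
rewrite w'w //; apply/esym; move: i ni; near: v; exact: (@near_prefix nat).
Unshelve. all: by end_near. Qed.

Section Reals.
Variable R : realType.

Lemma closed_real_Delta11 (C : set R) : closed C -> Delta11 C.
Proof.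
move=> cC; split; first exact: closed_Sigma11.
rewrite (_ : ~` C = \bigcup_(n : nat) [set x : R | forall y, C y -> n.+1%:R^-1 <= `|x - y|]); last first.
  rewrite eqEsubset; split=> [x nCx|x [n _ Hn] Cx]; last first.
    by have := Hn _ Cx; rewrite subrr normr0 leNgt invr_gt0 ltr0n.
  have : nbhs x (~` C) by apply: open_nbhs_nbhs; split => //; exact: closed_openC.
  move=> /nbhs_ballP[e /= e0 He]; have [n nE] := ltr_add_invr (y := 0) (x := e) e0.
  exists n => // y Cy; rewrite leNgt; apply/negP => h; apply: (He y) => //.
  by rewrite /ball /=; apply: lt_trans h _; rewrite add0r in nE.
apply: bigcup_Sigma11 => n; apply: closed_Sigma11.
rewrite (_ : [set _ | _] = \bigcap_(y in C) [set x | n.+1%:R^-1 <= `|x - y|]) //.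
apply: closed_bigI => y _.
apply: (@closed_pre _ _ (fun x : R => `|x - y|) [set z | n.+1%:R^-1 <= z]); last exact: closed_ge.
by move=> x; apply: cvg_norm; apply: cvgB; [exact: cvg_id|exact: cvg_cst].
Qed.
End Reals.

(** * Coin-tossing measure of a set given by its densities *)

Section Cylinders.
Implicit Types (u s v : seq bool) (x z : cantor_space).

Lemma size_restr x n : size (restr x n) = n.
Proof. exact: size_mkseq. Qed.

Lemma restrS x n : restr x n.+1 = rcons (restr x n) (x n).
Proof. exact: mkseqS. Qed.

Lemma cylE s x : cyl s x <-> restr x (size s) = s.
Proof.
split=> [H|<- i].
  apply: (@eq_from_nth _ false); first exact: size_restr.
  by move=> i; rewrite size_restr => si; rewrite nth_mkseq // H.
by rewrite size_restr => ni; rewrite /restr nth_mkseq.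
Qed.

Lemma cyl_restr x n : cyl (restr x n) x.
Proof. by apply/cylE; rewrite size_restr. Qed.

Lemma cyl_rcons u b x : cyl (rcons u b) x <-> cyl u x /\ x (size u) = b.
Proof.
split=> [H|[H Hb] i].
  split=> [i iu|]; last by rewrite H ?size_rcons // nth_rcons ltnn eqxx.
  by rewrite H ?size_rcons ?(leqW iu) // nth_rcons iu.
rewrite size_rcons ltnS leq_eqVlt nth_rcons => /predU1P[->|iu]; first by rewrite ltnn eqxx.
by rewrite iu H.
Qed.

Lemma restr_le x y m n : (m <= n)%N -> restr x n = restr y n -> restr x m = restr y m.
Proof.
move=> mn E; apply: (@eq_from_nth _ false); first by rewrite !size_restr.
move=> i; rewrite size_restr => im; have := congr1 (fun s => nth false s i) E.
by rewrite /restr !nth_mkseq // (leq_trans im).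
Qed.

Lemma near_restr x n : \forall y \near x, restr y n = restr x n.
Proof.
have FF : Filter (nbhs x) := nbhs_filter x.
elim: n => [|n IH]; first exact: (@nearW _ _ _ FF).
by apply: filterS2 IH (near_bits x n) => y E1 E2; rewrite !restrS E1 E2.
Qed.

Lemma nbhs_restr x U : nbhs x U -> exists n, forall y, restr y n = restr x n -> U y.
Proof.
move=> /(@nbhs_prefix bool)[n Hn]; exists n => y E; apply: Hn => i ni.
by have := congr1 (fun s => nth false s i) E; rewrite /restr !nth_mkseq.
Qed.

Lemma clopen_restr n (P : seq bool -> Prop) : clopen [set x | P (restr x n)].
Proof.
have op (Q : seq bool -> Prop) : open [set x | Q (restr x n)].
  rewrite openE => x /= Qx; rewrite /interior /=; have := near_restr x n.
  by apply: filterS => y /= ->.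
split; first exact: op.
rewrite (_ : [set _ | _] = ~` [set x | ~ P (restr x n)]).
  apply: open_closedC; exact: (op (fun v => ~ P v)).
by rewrite eqEsubset; split=> x /= => [?|/contrapT].
Qed.

Lemma clopen_cyl s : clopen (cyl s).
Proof.
rewrite (_ : cyl s = [set x | restr x (size s) = s]).
  exact: (clopen_restr (size s) (fun v => v = s)).
by rewrite eqEsubset; split=> x /cylE.
Qed.

(** Dependent choice on finite strings; it produces the points of [body] and also the branch that
    refutes too cheap a cover. *)
Lemma branch (Q : seq bool -> Prop) u : Q u ->
  (forall v, Q v -> exists b, Q (rcons v b)) ->
  exists x, cyl u x /\ forall n, (size u <= n)%N -> Q (restr x n).
Proof.
move=> Qu Qs.
have /choice[g Hg] v : exists b, Q v -> Q (rcons v b).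
  by have [/Qs[b ?]|?] := pselect (Q v); [exists b|exists true].
pose f m := iter m (fun v => rcons v (g v)) u.
pose x : cantor_space := fun i => if (i < size u)%N then nth false u i else g (f (i - size u)%N).
have xf m : restr x (size u + m) = f m.
  elim: m => [|m IH]; last first.
    by rewrite addnS restrS IH /= /x ltnNge leq_addr /= addKn.
  by rewrite addn0 /=; apply/cylE => i iu; rewrite /x iu.
exists x; split=> [|n]; first by move=> i iu; rewrite /x iu.
move=> /subnKC <-; rewrite xf; elim: (_ - _)%N => [//|m IH].
exact: Hg.
Qed.

End Cylinders.

Section CoinMeasure.
Variable R : realType.
Implicit Types (u s v : seq bool) (l : seq (seq bool)) (A : set cantor_space).

Definition weight s : R := 2%:R ^- size s.

Lemma weight_gt0 s : 0 < weight s.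
Proof. by rewrite /weight invr_gt0 exprn_gt0. Qed.

Lemma weight_rcons s b : weight (rcons s b) = weight s / 2.
Proof. by rewrite /weight size_rcons exprSr invfM. Qed.

Definition cylcover l : set cantor_space := [set x | exists2 s, s \in l & cyl s x].

Definition cost l : R := \sum_(s <- l) weight s.

Lemma coin_mu_ge0 A : (0 <= coin_mu R A)%E.
Proof.
apply: le_ereal_inf_tmp => v [s [_ ->]]; apply: nneseries_ge0 => n _ _.
by rewrite lee_fin ltW // weight_gt0.
Qed.

Lemma coin_mu_cover A l : A `<=` cylcover l -> (coin_mu R A <= (cost l)%:E)%E.
Proof.
move=> Al; apply/lee_addgt0Pr => e e0.
have [M HM] : exists M, (2%:R : R) ^- M < e.
  have := near_infty_natSinv_expn_lt (PosNum e0).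
  by case=> N _ /(_ N (leqnn N)) /=; rewrite div1r => h; exists N.
(* [coin_mu] asks for an infinite sequence, so the list is padded with ever longer strings of total
   weight below [e]. *)
pose s n := if (n < size l)%N then nth [::] l n else nseq (M + n.+1) false.
pose B n : \bar R := if (n < size l)%N then (weight (nth [::] l n))%:E else 0%:E.
have B0 n : (0 <= B n)%E by rewrite /B; case: ifP => _ //; rewrite lee_fin ltW // weight_gt0.
have BE : (\sum_(0 <= n <oo) B n)%E = (cost l)%:E.
  rewrite (@nneseries_split _ _ 0 (size l)) ?add0n; last by move=> k _; exact: B0.
  rewrite [X in (_ + X)%E]eseries0 ?adde0; last by move=> i li _; rewrite /B ltnNge li.
  rewrite /cost (big_nth [::]) -sumEFin big_nat [RHS]big_nat.
  by apply: eq_bigr => i /andP[_ il]; rewrite /B il.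
apply: (@le_trans _ _ (\sum_(0 <= n <oo) (weight (s n))%:E)%E).
  apply: ereal_inf_lbound; exists s; split => // x /Al[t tl tx].
  by exists (index t l) => //; rewrite /s index_mem tl nth_index.
rewrite -BE; apply: le_trans (epsilon_trick xpredT B0 (ltW e0)).
apply: lee_nneseries => n _; first by move=> _; rewrite lee_fin ltW // weight_gt0.
rewrite /s /B; case: ifP => _; first by rewrite leeDl // lee_fin divr_ge0 // ltW.
rewrite add0e lee_fin /weight size_nseq exprD invfM natrX ler_wpM2r ?invr_ge0 ?exprn_ge0 //.
exact: ltW.
Qed.

(* the measure of the intersection of cyl s and cyl u *)
Fixpoint meet_weight s u : R :=
  match s, u with
  | [::], _ => weight u
  | _ :: _, [::] => weight s
  | a :: s', b :: u' => if a == b then meet_weight s' u' / 2 else 0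
  end.

Lemma meet_weight_rcons s u :
  meet_weight s u = meet_weight s (rcons u false) + meet_weight s (rcons u true).
Proof.
have half (v : seq bool) b : weight (b :: v) = weight v / 2 by rewrite /weight /= exprSr invfM.
elim: s u => [|a s IH] [|b u] /=.
- by rewrite !half; field.
- by rewrite !half !weight_rcons; field.
- have w0 : meet_weight s [::] = weight s by case: (s) => [|? ?].
  by case: a; rewrite /= half w0 ?addr0 ?add0r.
by case: eqP => _; [rewrite IH; field|rewrite addr0].
Qed.

Lemma meet_weight_ge0 s u : 0 <= meet_weight s u.
Proof.
elim: s u => [|a s IH] [|b u] /=; try exact/ltW/weight_gt0.
by case: eqP => _ //; apply: divr_ge0.
Qed.

Lemma meet_weight_le s u : meet_weight s u <= weight s.
Proof.
elim: s u => [|a s IH] [|b u] //=.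
  rewrite /weight expr0 invr1 invf_le1 ?exprn_gt0 //.
  by rewrite exprn_ege1 // ler1n.
have -> : weight (a :: s) = weight s / 2 by rewrite /weight /= exprSr invfM.
case: eqP => _; last by rewrite divr_ge0 // ltW // weight_gt0.
by rewrite ler_wpM2r.
Qed.

Lemma meet_weight_prefix s u : prefix s u -> meet_weight s u = weight u.
Proof.
elim: s u => [|a s IH] [|b u] //=.
by move=> /andP[-> /IH ->]; rewrite /weight /= exprSr invfM.
Qed.

(* A martingale d that is eventually 0 or 1 on almost every branch: V dominates
   the undecided nodes and decreases geometrically on average. *)
Record decided (d V : seq bool -> R) : Prop := Decided {
  dec_ge0 : forall u, 0 <= d u;
  dec_le1 : forall u, d u <= 1;
  dec_mart : forall u, d (rcons u false) + d (rcons u true) = 2 * d u;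
  dec_V0 : forall u, 0 <= V u;
  dec_V : forall u, V (rcons u false) + V (rcons u true) <= 7 / 4 * V u;
  dec_dV : forall u, 0 < d u -> 1 <= d u + V u }.

Variables (d V : seq bool -> R).
Hypothesis H : decided d V.

Definition body : set cantor_space := [set x | forall n, 0 < d (restr x n)].

Lemma d_parent u b : 0 < d (rcons u b) -> 0 < d u.
Proof.
have := dec_mart H u; have := dec_ge0 H (rcons u false); have := dec_ge0 H (rcons u true).
by case: b => ? ? ? ?; lra.
Qed.

Lemma d_restr_le x m n : (m <= n)%N -> 0 < d (restr x n) -> 0 < d (restr x m).
Proof.
move=> /subnKC <-; elim: (_ - _)%N => [|k IH]; first by rewrite addn0.
by rewrite addnS restrS => /d_parent.
Qed.

Lemma body_meets u : 0 < d u -> exists2 x, body x & cyl u x.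
Proof.
move=> du; have [|x [ux Hx]] := @branch (fun v => 0 < d v) u du.
  move=> v dv; have := dec_mart H v => E.
  have [h|h] := ltP 0 (d (rcons v false)); first by exists false.
  by exists true; lra.
exists x => // n; have [un|/ltnW nu] := leqP (size u) n; first exact: Hx.
by apply: d_restr_le nu _; exact: Hx.
Qed.

Fixpoint live m u : seq (seq bool) :=
  if m is m'.+1 then live m' (rcons u false) ++ live m' (rcons u true)
  else if 0 < d u then [:: u] else [::].

Lemma live_cover m u : body `&` cyl u `<=` cylcover (live m u).
Proof.
elim: m u => [|m IH] u x [Kx ux] /=.
  by rewrite -(cylE u x).1 // Kx; exists (restr x (size u)); rewrite ?mem_seq1 //; exact: cyl_restr.
have [t tl tx] : cylcover (live m (rcons u (x (size u)))) x.
  by apply: IH; split => //; apply/cyl_rcons.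
by exists t => //; rewrite mem_cat; case: (x _) tl => ->; rewrite ?orbT.
Qed.

(** A positive node at the last level costs at most its weight times [d + V]. Averaging over the two
    children preserves [d] and multiplies [V] by at most 7/8, half of the 7/4 in [dec_V]. *)
Lemma live_cost m u : cost (live m u) <= weight u * (d u + (7 / 8) ^+ m * V u).
Proof.
elim: m u => [|m IH] u /=; rewrite /cost.
  rewrite expr0 mul1r; case: ifP => h; rewrite ?big_nil ?big_seq1.
    by rewrite ler_pMr ?weight_gt0 // (dec_dV H).
  by rewrite mulr_ge0 ?addr_ge0 ?(dec_ge0 H) ?(dec_V0 H) // ltW // weight_gt0.
rewrite big_cat /=; apply: le_trans (lerD (IH _) (IH _)) _.
rewrite !weight_rcons -!mulrA -mulrDr ler_wpM2l ?(ltW (weight_gt0 _)) //.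
rewrite -mulrDr exprSr; have := dec_mart H u; have := dec_V H u.
have : 0 <= (7 / 8 : R) ^+ m by rewrite exprn_ge0 // divr_ge0.
set q := _ ^+ m; move=> q0 HV Hd.
have := ler_wpM2l q0 HV; nra.
Qed.

(** Let [c v] be the total overlap of the cover with [cyl v]. It is additive over children, as is
    [weight v * d v], so a deficit at [u] passes to some child forever. The resulting branch has
    positive [d], hence lies in [body] and in some [cyl (s n)]; but deep inside that cylinder the
    overlap is at least the full weight, and no deficit is left. *)
Lemma cover_cost_ge (s : nat -> seq bool) u :
  body `&` cyl u `<=` \bigcup_n cyl (s n) ->
  ((weight u * d u)%:E <= \sum_(0 <= n <oo) (weight (s n))%:E)%E.
Proof.
move=> Kus; pose c v : \bar R := (\sum_(0 <= n <oo) (meet_weight (s n) v)%:E)%E.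
have mw0 n v : (0 <= (meet_weight (s n) v)%:E)%E by rewrite lee_fin meet_weight_ge0.
apply: (@le_trans _ _ (c u)); last first.
  by apply: lee_nneseries => n _ //; rewrite lee_fin meet_weight_le.
rewrite leNgt; apply/negP => cu.
have [v|x [ux Hx]] := @branch (fun v => (c v < (weight v * d v)%:E)%E) u cu.
  move=> cv; apply: contrapT => /forallNP nb.
  have cE : c v = (c (rcons v false) + c (rcons v true))%E.
    rewrite -nneseriesD //; apply: eq_eseriesr => n _.
    by rewrite -EFinD -meet_weight_rcons.
  move: cv; apply/negP; rewrite -leNgt cE.
  have -> : weight v * d v = weight (rcons v false) * d (rcons v false) +
                             weight (rcons v true) * d (rcons v true).
    by rewrite !weight_rcons -mulrDr (dec_mart H); field.
  by rewrite EFinD; apply: leeD; rewrite leNgt; apply/negP; exact: nb.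
have Kx : body x.
  have pos n : (size u <= n)%N -> 0 < d (restr x n).
    move=> /Hx h; have : (0 < (weight (restr x n) * d (restr x n))%:E)%E.
      by apply: le_lt_trans h; apply: nneseries_ge0.
    by rewrite lte_fin pmulr_rgt0 // weight_gt0.
  move=> n; have [/pos//|/ltnW nu] := leqP (size u) n.
  by apply: d_restr_le nu _; exact: pos.
have [n _ /cylE sx] := Kus x (conj Kx ux).
pose N := maxn (size u) (size (s n)).
have := Hx N (leq_maxl _ _); apply/negP; rewrite -leNgt.
apply: (@le_trans _ _ (meet_weight (s n) (restr x N))%:E).
  rewrite meet_weight_prefix; last first.
    have -> : N = (size (s n) + (N - size (s n)))%N by rewrite subnKC // leq_maxr.
    by rewrite -{1}sx /restr /mkseq iotaD map_cat prefix_prefix.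
  by rewrite lee_fin ler_piMr ?(dec_le1 H) // ltW // weight_gt0.
apply: le_trans (@nneseries_lim_ge _ _ xpredT 0 n.+1 _); last by move=> *; exact: mw0.
rewrite big_nat_recr //= leeDr // sume_ge0 => // *; exact: mw0.
Qed.

(** The live nodes at depth [n] give covers whose excess [(7 / 8) ^+ n * V u] tends to 0, which
    matches the lower bound. *)
Lemma coin_mu_body u : coin_mu R (body `&` cyl u) = (weight u * d u)%:E.
Proof.
apply/eqP; rewrite eq_le; apply/andP; split; last first.
  apply: le_ereal_inf_tmp => v [s [Hs ->]]; exact: cover_cost_ge.
apply/lee_addgt0Pr => e e0.
have V1 : 0 < V u + 1 by rewrite ltr_wpDl ?(dec_V0 H).
have : (7 / 8 : R) ^+ n @[n --> \oo] --> (0 : R).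
  by apply: cvg_expr; rewrite ger0_norm; lra.
move/cvgrPdist_lt => /(_ (e / (V u + 1)) (divr_gt0 e0 V1)) [n _ /(_ n (leqnn n))].
rewrite sub0r normrN ger0_norm; last by rewrite exprn_ge0 // divr_ge0.
rewrite ltr_pdivlMr // => hn.
apply: le_trans (coin_mu_cover (@live_cover n u)) _.
rewrite -EFinD lee_fin; apply: le_trans (live_cost n u) _.
rewrite mulrDr lerD2l.
have w1 : weight u <= 1.
  by rewrite /weight invf_le1 ?exprn_gt0 // exprn_ege1 // ler1n.
have w0 := weight_gt0 u; have V0 := dec_V0 H u.
have q0 : 0 <= (7 / 8 : R) ^+ n by rewrite exprn_ge0 // divr_ge0.
apply: (@le_trans _ _ ((7 / 8) ^+ n * V u)); last by lra.
by rewrite ler_piMl // mulr_ge0.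
Qed.

Lemma density_seq_body z n : density_seq R body z n = d (restr z n).
Proof.
rewrite /density_seq coin_mu_body /= /weight size_restr mulrAC divff ?mul1r //.
Qed.
End CoinMeasure.

(** * Binary digits and the automaton *)

Section Digits.
Variable R : realType.
Implicit Types (s : seq nat) (w y : baire).

(* nodes are stored in reverse, most recent entry first *)
Definition rad (n : nat) : R := 2%:R ^- n.+1.
Definition sgn (n : nat) : R := if odd n then 1 else -1.

(** Centre of the dyadic interval whose binary digits are the parities of the entries of [s];
    [rad (size s)] is its half-length. *)
Fixpoint ctr s : R :=
  if s is n :: s' then ctr s' + sgn n * (rad (size s') / 2) else 2^-1.

Fixpoint pre w n : seq nat := if n is m.+1 then w m :: pre w m else [::].

Lemma size_pre w n : size (pre w n) = n.
Proof. by elim: n => //= n ->. Qed.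

Lemma near_pre w n : \forall v \near w, pre v n = pre w n.
Proof.
have FF : Filter (nbhs w) := nbhs_filter w.
have := @near_prefix nat w n; apply: filterS => v.
by elim: n => //= n IH H; rewrite H // IH // => i ni; apply: H; exact: ltnW.
Qed.

Lemma nbhs_pre w U : nbhs w U -> exists n, forall v, pre v n = pre w n -> U v.
Proof.
move=> /(@nbhs_prefix nat)[n Hn]; exists n => v E; apply: Hn.
elim: n E => //= n IH [E1 E2] i.
by rewrite ltnS leq_eqVlt => /predU1P[->//|]; exact: IH.
Qed.

Lemma rad_gt0 n : 0 < rad n.
Proof. by rewrite /rad invr_gt0 exprn_gt0. Qed.

Lemma radS n : rad n.+1 = rad n / 2.
Proof. by rewrite /rad exprSr invfM. Qed.

Lemma rad_le m n : (m <= n)%N -> rad n <= rad m.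
Proof.
move=> /subnKC <-; elim: (_ - _)%N => [|k IH]; first by rewrite addn0.
by rewrite addnS radS; have := rad_gt0 (m + k); lra.
Qed.

Lemma rad_small (e : R) : 0 < e -> exists n, rad n < e.
Proof.
move=> e0; have [N _ /(_ N (leqnn N)) /=] := near_infty_natSinv_expn_lt (PosNum e0).
rewrite div1r => h; exists N; apply: le_lt_trans h.
rewrite /rad exprSr invfM; have : 0 < (2 : R) ^- N by rewrite invr_gt0 exprn_gt0.
lra.
Qed.

Lemma ctr_bounds s : rad (size s) <= ctr s <= 1 - rad (size s).
Proof.
elim: s => [|n s /andP[l u]] /=; first by rewrite /rad expr1; apply/andP; split; lra.
by have := rad_gt0 (size s); rewrite radS /sgn; case: odd => ?; apply/andP; split; lra.
Qed.

Definition phi w : R := sup [set ctr (pre w n) - rad n | n in setT].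

Lemma phi_near w n : `|phi w - ctr (pre w n)| <= rad n.
Proof.
pose lo m := ctr (pre w m) - rad m; pose up m := ctr (pre w m) + rad m.
have loS m : lo m <= lo m.+1.
  by rewrite /lo /= radS size_pre /sgn; have := rad_gt0 m; case: odd; lra.
have upS m : up m.+1 <= up m.
  by rewrite /up /= radS size_pre /sgn; have := rad_gt0 m; case: odd; lra.
have lo_mono m k : lo m <= lo (m + k)%N.
  by elim: k => [|k IH]; rewrite ?addn0 // addnS; exact: le_trans (loS _).
have up_mono m k : up (m + k)%N <= up m.
  by elim: k => [|k IH]; rewrite ?addn0 // addnS; exact: le_trans IH.
have loup m k : lo m <= up k.
  apply: le_trans (lo_mono m k) _; apply: le_trans (_ : up (m + k)%N <= _).
    by rewrite /lo /up; have := rad_gt0 (m + k); lra.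
  by rewrite addnC; exact: up_mono.
have h1 : lo n <= phi w.
  apply: ub_le_sup; last by exists n.
  by exists (up 0%N) => _ [m _ <-]; exact: loup.
have h2 : phi w <= up n.
  by apply: ge_sup; [exists (lo 0%N), 0%N|move=> _ [m _ <-]; exact: loup].
by rewrite ler_norml; move: h1 h2; rewrite /lo /up => ? ?; apply/andP; split; lra.
Qed.

Lemma phi_unique w r : (forall n, `|r - ctr (pre w n)| <= rad n) -> r = phi w.
Proof.
move=> H; apply/eqP; rewrite -subr_eq0 -normr_le0 leNgt; apply/negP => h.
have [n hn] := rad_small h.
have := H n.+1; have := phi_near w n.+1; rewrite radS !ler_norml => /andP[? ?] /andP[? ?].
have : `|r - phi w| <= rad n by rewrite ler_norml; apply/andP; split; lra.
by rewrite leNgt hn.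
Qed.

Lemma phi01 w : 0 <= phi w <= 1.
Proof.
have := phi_near w 0; rewrite /= /rad expr1 ler_norml => /andP[? ?].
by apply/andP; split; lra.
Qed.

Lemma phi_continuous : continuous phi.
Proof.
move=> w; apply/cvgrPdist_lt => e e0; have [n hn] := rad_small e0.
have FF : Filter (nbhs w) := nbhs_filter w.
have := near_pre w n.+1; apply: filterS => v E.
have := phi_near w n.+1; have := phi_near v n.+1; rewrite E radS !ler_norml => /andP[? ?] /andP[? ?].
by rewrite ltr_norml; apply/andP; split; lra.
Qed.

(** Only parities affect [phi], so the halves of the entries are free to carry an arbitrary [y]. The
    parity is 1 exactly when [r] is at or above the current centre. *)
Lemma phi_onto (r : R) y : 0 <= r <= 1 ->
  exists2 w, phi w = r & (fun i => (w i)./2) = y.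
Proof.
move=> /andP[r0 r1].
pose f := fix f n := if n is m.+1 then ((ctr (f m) <= r)%R + (y m).*2)%N :: f m else [::].
pose w : baire := fun m => ((ctr (f m) <= r)%R + (y m).*2)%N.
have wf n : pre w n = f n by elim: n => //= n ->.
exists w; last by apply/funext => i; rewrite /w; case: (_ <= _); rewrite /= ?uphalf_double ?doubleK.
apply/esym/phi_unique => n; rewrite wf.
have sf m : size (f m) = m by rewrite -wf size_pre.
elim: n => [|n]; first by rewrite /= /rad expr1 ler_norml; apply/andP; split; lra.
rewrite /= radS sf /sgn oddD odd_double addbF oddb !ler_norml; have := rad_gt0 n.
by case: (leP (ctr (f n)) r) => ? ? /andP[? ?]; apply/andP; split; lra.
Qed.
End Digits.

(** * The automaton and its martingale of local densities *)

Section Machine.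
Variable R : realType.
Variable T : seq nat -> bool.

(* Dec d carves out a set of density d with no density values outside {0,1};
   Nd s k sits k zeros below the node s. *)
Inductive state := Dec of R | Nd of seq nat & nat.

(** The sequence 0, 1, 0, -1 of period four. *)
Definition osc (k : nat) : R := if odd k then (if odd k./2 then -1 else 1) else 0.

Definition dens (q : state) : R :=
  match q with Dec d => d | Nd s k => ctr R s + osc k * (rad R (size s) / 2) end.

(** [Dec d] fills the zero half first, so it describes an initial segment in the lexicographic
    order. At odd [k] the exit density is forced by the martingale identity; it is an endpoint of
    the interval of [s]. *)
Definition step (q : state) (b : bool) : state :=
  match q with
  | Dec d => Dec (if b then Num.max 0 (2 * d - 1) else Num.min 1 (2 * d))
  | Nd s k =>
      if ~~ b then Nd s k.+1
      else if odd k then Dec (2 * dens (Nd s k) - dens (Nd s k.+1))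
      else if T (k./2 :: s) then Nd (k./2 :: s) 0 else Dec (ctr R (k./2 :: s))
  end.

Definition run (u : seq bool) : state := foldl step (Nd [::] 0) u.

Lemma run_rcons u b : run (rcons u b) = step (run u) b.
Proof. by rewrite /run foldl_rcons. Qed.

(** The values make [dec_V] hold: from 8 the children total at most 6 + 8 = 7/4 * 8, from 6 at most
    8 + 1, and from an undecided [Dec] at most 1, since one of its two children has density 0 or
    1. *)
Definition potential (q : state) : R :=
  match q with
  | Dec d => if 0 < d < 1 then 1 else 0
  | Nd _ k => if odd k then 6 else 8
  end.

Lemma osc_even k : ~~ odd k -> osc k = 0.
Proof. by rewrite /osc => /negbTE ->. Qed.

(** At even [k] the exit leads to the centre of one half of the interval of [s], so the zero child
    must sit at the centre of the other half for the two to average to the centre of [s]. *)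
Lemma osc_odd k : ~~ odd k -> osc k.+1 = - sgn R k./2.
Proof. by move=> ek; rewrite /osc /sgn /= ek uphalf_half (negbTE ek) add0n; case: odd; rewrite ?opprK. Qed.

Lemma osc_abs k : -1 <= osc k <= 1.
Proof. by rewrite /osc; do 2?case: ifP => _; apply/andP; split; lra. Qed.

Lemma dens_near s k : `|dens (Nd s k) - ctr R s| <= rad R (size s) / 2.
Proof.
have := osc_abs k; have := rad_gt0 R (size s); rewrite ler_norml /= => ? /andP[? ?].
by apply/andP; split; nra.
Qed.

Lemma dens_step q : dens (step q false) + dens (step q true) = 2 * dens q.
Proof.
case: q => [d|s k] /=.
  by rewrite /Num.max /Num.min; do 2?case: ifPn; rewrite -?leNgt => *; lra.
case: ifPn => [ok|ek]; first by rewrite /=; lra.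
suff -> : dens (if T (k./2 :: s) then Nd (k./2 :: s) 0 else Dec (ctr R (k./2 :: s))) = ctr R (k./2 :: s).
  by rewrite (osc_odd ek) (osc_even ek) /=; lra.
by case: ifP => _ //=; rewrite mul0r addr0.
Qed.

Lemma dens01 u : 0 <= dens (run u) <= 1.
Proof.
have ndb s k : 0 <= dens (Nd s k) <= 1.
  have := dens_near s k; have /andP[? ?] := ctr_bounds R s; have := rad_gt0 R (size s).
  by rewrite ler_norml => ? /andP[? ?]; apply/andP; split; lra.
elim/last_ind: u => [|u b]; first exact: ndb.
rewrite run_rcons; case: (run u) => [d|s k] /=.
  by rewrite /Num.max /Num.min; case: b; case: ifPn; rewrite -?leNgt => ? /andP[? ?]; apply/andP; split; lra.
move=> _; case: b => /=; last exact: ndb.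
case: ifPn => ok; last first.
  have /andP[? ?] := ctr_bounds R (k./2 :: s); have := rad_gt0 R (size (k./2 :: s)).
  by case: ifP => _ ?; [exact: ndb|rewrite [dens _]/=; apply/andP; split; rewrite -/(ctr R (k./2 :: s)); lra].
have /andP[? ?] := ctr_bounds R s; have /andP[? ?] := osc_abs k; have := rad_gt0 R (size s).
rewrite [dens (Dec _)]/= (@osc_even k.+1); last by rewrite /= negbK.
move=> ?.
by apply/andP; split; nra.
Qed.

Lemma decided_run : decided (fun u => dens (run u)) (fun u => potential (run u)).
Proof.
split.
- by move=> u; case/andP: (dens01 u).
- by move=> u; case/andP: (dens01 u).
- by move=> u; rewrite !run_rcons dens_step.
- by move=> u; case: (run u) => [d|s k] /=; case: ifP.
- move=> u; rewrite !run_rcons; case: (run u) => [d|s k] /=.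
    case: (ltP 0 d) => d0; case: (ltP d 1) => d1 /=;
    rewrite /Num.max /Num.min; repeat case: ifPn; rewrite -?leNgt ?negb_and -?leNgt; try (by lra);
    try by move=> *; lra.
  have [ok|ok] := boolP (odd k) => /=.
    by case: ifP => _; lra.
  by case: ifP => _ /=; [lra|case: ifP => _; lra].
- move=> u; have := dens01 u; case: (run u) => [d|s k] /andP[h0 h1] h /=.
    move: h0 h1 h => /= h0 h1 h; rewrite h /=; case: ltP => ?; lra.
  by move: h0; rewrite [dens _]/=; case: ifP => _ ?; lra.
Qed.

Definition tree_body : set cantor_space := body (fun u => dens (run u)).

Lemma compact_tree_body : compact tree_body.
Proof.
apply: (@subclosed_compact _ _ setT) => //; last exact: cantor_space_compact.
rewrite (_ : tree_body = \bigcap_n [set x | 0 < dens (run (restr x n))]); last first.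
  by rewrite eqEsubset; split=> [x Kx n _|x Kx n]; [exact: Kx|exact: (Kx n Logic.I)].
apply: closed_bigI => n _; exact: (clopen_restr n (fun v => is_true (0 < dens (run v)))).2.
Qed.

Lemma density_tree_body (x : cantor_space) n : density_seq R tree_body x n = dens (run (restr x n)).
Proof. exact: (density_seq_body decided_run). Qed.

End Machine.

(** * Range of the density function *)

Section Range.
Variable R : realType.
Variable T : seq nat -> bool.
Local Notation run := (@run R T).
Local Notation step := (@step R T).

Definition traj (x : cantor_space) n : state R := run (restr x n).

Lemma trajS x n : traj x n.+1 = step (traj x n) (x n).
Proof. by rewrite /traj restrS run_rcons. Qed.

Lemma density_at_tree_body x r :
  density_at (tree_body R T) x r <-> dens (traj x n) @[n --> \oo] --> r.
Proof.
rewrite /density_at (_ : (fun n => _) = (fun n => dens (traj x n))) //.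
by apply/funext => n; rewrite density_tree_body.
Qed.

(* Once in a Dec state, the density obeys the doubling map, whose only limits
   along an orbit are 0 and 1. *)
Lemma dec_limit x n d (r : R) : traj x n = Dec d ->
  dens (traj x m) @[m --> \oo] --> r -> 0 <= r <= 1 -> r = 0 \/ r = 1.
Proof.
move=> qn cr /andP[r0 r1]; apply: contrapT => /not_orP[/eqP n0 /eqP n1].
have {}r0 : 0 < r by rewrite lt_neqAle eq_sym n0.
have {}r1 : r < 1 by rewrite lt_neqAle n1.
have dec m : exists d, traj x (n + m) = Dec d.
  elim: m => [|m [d' E]]; first by exists d; rewrite addn0.
  by rewrite addnS trajS E /=; eexists.
(* Two consecutive values within [e] of [r] would make [r] nearly a fixed point of the doubling map,
   while [r] is at least [8 * e] away from 0 and 1. *)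
pose e := Num.min r (1 - r) / 8.
have e0 : 0 < e by rewrite divr_gt0 // lt_min subr_gt0 r0 r1.
have er : 8 * e <= r by rewrite /e mulrCA divff // mulr1 ge_min lexx.
have er1 : 8 * e <= 1 - r by rewrite /e mulrCA divff // mulr1 ge_min lexx orbT.
move/cvgrPdist_lt : cr => /(_ e e0)[N _ HN].
have [d' E] := dec N.
have := HN (n + N)%N (leq_addl _ _); have := HN (n + N).+1 (leqW (leq_addl _ _)).
rewrite /= trajS E /= !ltr_norml; clear E qn dec HN.
by case: (x _) => /=; rewrite /Num.max /Num.min;
  case: ifPn; rewrite -?leNgt => ? /andP[? ?] /andP[? ?]; lra.
Qed.

Lemma osc_no_limit x n s k (r : R) : traj x n = Nd R s k ->
  (forall m, (n <= m)%N -> x m = false) ->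
  ~ dens (traj x m) @[m --> \oo] --> r.
Proof.
move=> qn x0 cr.
have E j : traj x (n + j) = Nd R s (k + j).
  elim: j => [|j IH]; first by rewrite !addn0.
  by rewrite !addnS trajS IH x0 ?leq_addr.
have e0 : 0 < rad R (size s) / 8 by rewrite divr_gt0 // rad_gt0.
move/cvgrPdist_lt : cr => /(_ _ e0)[N _ HN].
(* Then [k + j] is a multiple of four: [osc] is 0 there and 1 one step later, a jump of half of
   [rad]. *)
pose j := (4 * (N + k) - k)%N.
have kj : (k + j = (N + k).*2.*2)%N by rewrite /j; lia.
have Nj : (N <= n + j)%N by rewrite /j; lia.
have := HN (n + j)%N Nj; have := HN (n + j).+1 (leqW Nj).
rewrite /= -addnS !E addnS kj /= /osc /= odd_double /= uphalf_double odd_double !ltr_norml.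
by clear E qn HN => /andP[? ?] /andP[? ?]; lra.
Qed.

(* Along a branch w of the tree the densities stay in shrinking dyadic
   intervals around phi w. *)
Lemma branch_limit (q : nat -> state R) (w : baire) (i : nat -> nat) :
  (forall n, exists k, q n = Nd R (pre w (i n)) k) ->
  (forall j, exists N, forall n, (N <= n)%N -> (j <= i n)%N) ->
  dens (q n) @[n --> \oo] --> phi R w.
Proof.
move=> qi iu; apply/cvgrPdist_lt => e e0.
have [j je] : exists j, rad R j < e / 2 by apply: rad_small; rewrite divr_gt0.
have [N HN] := iu j; exists N => // n /= /HN ji.
have [k ->] := qi n; have := dens_near R (pre w (i n)) k; have := phi_near R w (i n).
rewrite size_pre; have := rad_le R ji; have := rad_gt0 R (i n).
by rewrite !ler_norml ltr_norml => ? ? /andP[? ?] /andP[? ?]; apply/andP; split; lra.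
Qed.

Definition node (q : state R) : seq nat := if q is Nd s _ then s else [::].

(** Ones are read infinitely often and never lead to [Dec], so each of them lengthens the current
    node; the nodes grow along a single branch [w]. *)
Lemma branch_of_traj x (r : R) :
  (forall n s k, traj x n = Nd R s k -> exists2 m, (n <= m)%N & x m = true) ->
  (forall n d, traj x n <> Dec d) ->
  dens (traj x m) @[m --> \oo] --> r ->
  exists2 w : baire, (forall i, T (pre w i.+1)) & r = phi R w.
Proof.
move=> xt nd cr; pose s n := node (traj x n).
have qE n : exists k, traj x n = Nd R (s n) k.
  by rewrite /s; case E: (traj x n) => [d|s' k] /=; [have := nd n d|exists k].
have sS n : (x n = false /\ s n.+1 = s n) \/ exists2 m, s n.+1 = m :: s n & T (m :: s n).
  have [k E] := qE n; have := nd n.+1; rewrite /s trajS E.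
  case: (x n) => /=; last by left.
  case: ifP => _; first by move=> /(_ _ erefl).
  by case: ifP => Tk; [right; exists k./2|move=> /(_ _ erefl)].
have s_mono m n : (m <= n)%N -> (size (s m) <= size (s n))%N.
  move=> /subnKC <-; elim: (_ - _)%N => [|k IH]; first by rewrite addn0.
  by rewrite addnS; apply: leq_trans IH _; case: (sS (m + k)%N) => [[_ ->]|[? ->]] /=.
have unb j : exists n, (j < size (s n))%N.
  have step n : exists m, (size (s n) < size (s m))%N.
    have [k E] := qE n; have [m nm xm] := xt _ _ _ E; exists m.+1.
    apply: leq_ltn_trans (s_mono _ _ nm) _.
    by case: (sS m) => [[]|[? ->]]; rewrite ?xm.
  elim: j => [|j [n jn]]; first by have [m sm] := step 0%N; exists m; apply: leq_ltn_trans sm.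
  by have [m sm] := step n; exists m; apply: leq_ltn_trans sm.
(* At the first time the node has more than [j] entries, its most recent entry is the one of index
   [j]. *)
pose w : baire := fun j => head 0%N (s (ex_minn (unb j))).
have sw n : s n = pre w (size (s n)).
  elim: n => [//|n IH]; case: (sS n) => [[_ ->]//|[m E _]].
  rewrite E /= -IH; congr cons; rewrite /w; case: ex_minnP => N hN minN.
  have Nn : (N <= n.+1)%N by apply: minN; rewrite E.
  have nN : (n < N)%N by rewrite ltnNge; apply/negP => /s_mono; rewrite leqNgt hN.
  have -> : N = n.+1 by apply/eqP; rewrite eqn_leq Nn nN.
  by rewrite E.
exists w => [i|].
  case: (ex_minnP (unb i)) => -[//|n] hN minN.
  case: (sS n) => [[_ E]|[m E Tm]].
    by have := minN n; rewrite -E => /(_ hN); rewrite ltnn.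
  have ni : (size (s n) <= i)%N.
    by rewrite leqNgt; apply/negP => /minN; rewrite ltnn.
  have -> : i.+1 = size (s n.+1).
    by apply/eqP; rewrite eqn_leq hN E /= ltnS ni.
  by rewrite -sw E.
have cw : dens (traj x n) @[n --> \oo] --> phi R w.
  apply: (branch_limit (i := fun n => size (s n))) => [n|j].
    by have [k E] := qE n; exists k; rewrite -sw.
  have [N hN] := unb j; exists N => n Nn; exact/ltnW/(leq_trans hN)/s_mono.
exact: (cvg_unique (@norm_hausdorff _ R) cr cw).
Qed.

(** The point reads [2 * w i] zeros and then a one, for each [i] in turn; [Q] describes the prefixes
    of this itinerary. *)
Lemma branch_point (w : baire) : (forall i, T (pre w i.+1)) ->
  exists x, density_at (tree_body R T) x (phi R w).
Proof.
move=> Tw.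
pose Q v := exists i k, run v = Nd R (pre w i) k /\ (k <= (w i).*2)%N.
have [||x [_ Hx]] := @branch Q [::].
- by exists 0%N, 0%N.
- move=> v [i [k [E ki]]]; have [kw|wk] := ltnP k (w i).*2.
    by exists false, i, k.+1; rewrite run_rcons E.
  exists true, i.+1, 0%N; rewrite run_rcons E.
  have -> : k = (w i).*2 by apply/eqP; rewrite eqn_leq ki.
  by rewrite /= odd_double doubleK (Tw i).
have {Hx} Hx n : Q (restr x n) by exact: Hx.
exists x; apply/density_at_tree_body; have [i Hi] := choice Hx.
apply: (branch_limit (i := i)) => [n|]; first by have [k [? _]] := Hi n; exists k.
have iS n : (i n <= i n.+1)%N.
  have [k [E _]] := Hi n; have [k' [E' _]] := Hi n.+1; move: E'.
  rewrite restrS run_rcons E /=; case: (x n) => /=.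
    case: ifP => // _; case: ifP => // _ [] /(congr1 size) /=.
    by rewrite !size_pre => <- _.
  by case => /(congr1 size); rewrite !size_pre => <-.
have i_mono m n : (m <= n)%N -> (i m <= i n)%N.
  move=> /subnKC <-; elim: (_ - _)%N => [|k IH]; first by rewrite addn0.
  by rewrite addnS; apply: leq_trans IH _.
(* If the node never changed again, the zeros read below it would exceed the bound [(w i).*2] in
   [Q]. *)
have grow n : exists m, (i n < i m)%N.
  apply: contrapT => /forallNP nm.
  have im t : i (n + t)%N = i n.
    by apply/eqP; rewrite eqn_leq (i_mono n (n + t)%N) ?leq_addr // andbT leqNgt; apply/negP; exact: nm.
  have [k [E _]] := Hi n.
  have F t : run (restr x (n + t)) = Nd R (pre w (i n)) (k + t).
    elim: t => [|t IH]; first by rewrite !addn0.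
    have [k' [E' _]] := Hi (n + t.+1)%N; move: E'; rewrite im addnS restrS run_rcons IH /=.
    case: (x _) => /=; last by rewrite addnS.
    case: ifP => // _; case: ifP => // _ [] /(congr1 size) /=.
    by rewrite !size_pre => /esym /n_Sn.
  have [k' [E' ]] := Hi (n + (w (i n)).*2.+1)%N; rewrite im; move: E'; rewrite im F => -[<-].
  by rewrite addnS ltnNge leq_addl.
elim=> [|j [N HN]]; first by exists 0%N.
have [m Nm] := grow N; exists m => n mn.
by apply: leq_ltn_trans (HN N (leqnn N)) _; apply: leq_trans Nm (i_mono _ _ mn).
Qed.

Lemma decided_point u (d : R) : run u = Dec d -> d = 0 \/ d = 1 ->
  exists x, density_at (tree_body R T) x d.
Proof.
move=> ru d01; pose x : cantor_space := nth false u.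
exists x; apply/density_at_tree_body.
have xu : restr x (size u) = u by apply/cylE => i.
have E m : traj x (size u + m) = Dec d.
  elim: m => [|m IH]; first by rewrite addn0 /traj xu.
  rewrite addnS trajS IH /=; congr Dec; clear IH ru; case: (x _); case: d01 => ->;
  by rewrite /Num.max /Num.min; case: ifPn; rewrite -?leNgt; lra.
apply/cvgrPdist_lt => e e0; exists (size u) => // n /= /subnKC <-.
by rewrite E subrr normr0.
Qed.

(** A trajectory with a limit either enters [Dec], giving 0 or 1, or follows a branch; staying below
    one node forever makes the density oscillate. *)
Lemma density_range_tree_body : density_range (tree_body R T) =
  [set 0; 1] `|` [set phi R w | w in [set w : baire | forall i, T (pre w i.+1)]].
Proof.
rewrite eqEsubset; split=> [r [x /density_at_tree_body cr]|r [[->|->]|[w Tw <-]]]; last 1 first.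
- exact: branch_point.
- have r01 : 0 <= r <= 1.
    have b n : 0 <= dens (traj x n) <= 1 by exact: dens01.
    rewrite -(cvg_lim (@norm_hausdorff _ R) cr); apply/andP; split.
      by apply: limr_ge; [apply/cvg_ex; exists r|apply: nearW => n; case/andP: (b n)].
    by apply: limr_le; [apply/cvg_ex; exists r|apply: nearW => n; case/andP: (b n)].
  have [[n [d E]]|nd] := pselect (exists n d, traj x n = Dec d).
    by left; exact: dec_limit E cr r01.
  have [w Tw ->] : exists2 w : baire, (forall i, T (pre w i.+1)) & r = phi R w.
    apply: (@branch_of_traj x) => // [n s k E|n d E]; last by apply: nd; exists n, d.
    apply: contrapT => /forall2NP H; apply: (osc_no_limit E _ cr) => m nm.
    by case: (H m) => [//|/negP/negbTE].
  by right; exists w.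
(* Below the root the density after three zeros is 1/4, so the exit has density 2 * 1/4 - 1/2 =
   0. *)
- apply: (@decided_point [:: false; false; false; true]); last by left.
  by rewrite /run /= /osc /= /rad; congr Dec; rewrite expr1; lra.
(* After one zero the density is 3/4, and the exit has density 2 * 3/4 - 1/2 = 1. *)
- apply: (@decided_point [:: false; true]); last by right.
  by rewrite /run /= /osc /= /rad; congr Dec; rewrite expr1; lra.
Qed.
End Range.

(** * Continuity into the hyperspace *)

Lemma open_hyperK (p : set cantor_space * bool) : open p.1 -> open (vietoris_subbase p).
Proof.
move=> op; rewrite openE => K pK.
exists (vietoris_subbase p); split=> //; exists [set vietoris_subbase p]; last first.
  by rewrite predeqE => ?; split=> [[_ ->]|] //; exists (vietoris_subbase p).
move=> _ ->; exists (finmap.fset1 p).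
  by move=> ?; rewrite finmap.in_fset1 => /eqP ->; rewrite inE.
rewrite predeqE=> ?; split=> [H|? q /=]; first by apply: H; rewrite /= finmap.in_fset1.
by rewrite finmap.in_fset1 => /eqP ->.
Qed.

Lemma open_sub (O : set cantor_space) : open O -> open [set K : hyperK | proj1_sig K `<=` O].
Proof. exact: (@open_hyperK (O, true)). Qed.

Lemma open_meet (O : set cantor_space) : open O ->
  open [set K : hyperK | proj1_sig K `&` O !=set0].
Proof. exact: (@open_hyperK (O, false)). Qed.

Lemma clopen_sub (O : set cantor_space) : clopen O -> clopen [set K : hyperK | proj1_sig K `<=` O].
Proof.
move=> [oO cO]; split; first exact: open_sub.
rewrite (_ : [set _ | _] = ~` [set K : hyperK | proj1_sig K `&` ~` O !=set0]).
  by apply: open_closedC; apply: open_meet; exact: closed_openC.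
rewrite eqEsubset; split=> [K KO [x [/KO]]//|K /= H x Kx].
by apply: contrapT => nO; apply: H; exists x.
Qed.

Lemma continuous_hyperK (Z : topologicalType) (f : Z -> hyperK) :
  (forall O z, open O -> proj1_sig (f z) `<=` O -> \forall y \near z, proj1_sig (f y) `<=` O) ->
  (forall O z, open O -> proj1_sig (f z) `&` O !=set0 ->
     \forall y \near z, proj1_sig (f y) `&` O !=set0) ->
  continuous f.
Proof.
move=> fs fm z A /=; rewrite (@nbhsE hyperK).
move=> [_ [[B sB <-] [C BC Ct] sUBA]].
rewrite nbhs_filterE; apply: filterS sUBA _; apply: (@filterS _ _ _ C).
  by move=> ? ?; exists C.
have /sB [D sD IDeC] := BC; rewrite -IDeC; apply: filter_bigI => E DE.
have /sD := DE; rewrite inE /= => oE; move: Ct; rewrite -IDeC => /(_ _ DE).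
case: E oE {DE} => O b /= oO; rewrite /vietoris_subbase /preimage /=.
by case: b => h; [exact: fs oO h|exact: fm oO h].
Qed.

(** A Lebesgue number: cover [K] by finitely many cylinders inside [O] and take the longest
    length. *)
Lemma compact_prefix (K O : set cantor_space) : compact K -> open O -> K `<=` O ->
  exists n, forall x y, K x -> restr y n = restr x n -> O y.
Proof.
move=> cK oO KO.
have /choice[m Hm] (x : cantor_space) : exists m, K x -> forall y, restr y m = restr x m -> O y.
  have [/KO Ox|?] := pselect (K x); last by exists 0%N.
  have [m Hm] : exists m, forall y, restr y m = restr x m -> O y.
    by apply: nbhs_restr; exact: open_nbhs_nbhs.
  by exists m.
have := cK; rewrite compact_cover.
move=> /(_ cantor_space K (fun x => cyl (restr x (m x))))[||D DK KD].
- by move=> x _; exact: (clopen_cyl _).1.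
- by move=> x Kx; exists x => //; exact: cyl_restr.
exists (\max_(x <- finmap.enum_fset D) m x)%N => x y Kx yx.
have [a /= aD ax] := KD x Kx; apply: (Hm a); first exact/set_mem/DK.
have le : (m a <= \max_(x <- finmap.enum_fset D) m x)%N by exact: leq_bigmax_seq.
have E : restr x (m a) = restr a (m a) by move/cylE: ax; rewrite size_restr.
by rewrite -E; exact: restr_le le yx.
Qed.

Section Continuity.
Variable R : realType.
Variables (Z : topologicalType) (T : Z -> seq nat -> bool).
Hypothesis T_near : forall z s, \forall y \near z, T y s = T z s.

Definition tree_hyperK (U : seq nat -> bool) : hyperK := exist _ (tree_body R U) (@compact_tree_body R U).

Lemma near_run z u : \forall y \near z, run R (T y) u = run R (T z) u.
Proof.
elim/last_ind: u => [|u b]; first exact: nearW.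
have : \forall y \near z, step (T y) (run R (T z) u) b = step (T z) (run R (T z) u) b.
  case: (run _ _) => [d|s k] /=; first exact: nearW.
  by have := T_near z (k./2 :: s); apply: filterS => y /= ->.
by apply: filterS2 => y E1 E2; rewrite !run_rcons E2.
Qed.

Lemma near_run_all z n :
  \forall y \near z, forall u, size u = n -> run R (T y) u = run R (T z) u.
Proof.
have : \forall y \near z, forall t : n.-tuple bool, run R (T y) t = run R (T z) t.
  by apply: filter_forall => t; exact: near_run.
by apply: filterS => y H u /eqP su; exact: (H (Tuple su)).
Qed.

(** The body meets the cylinder of [u] exactly when [run u] has positive density, and [run u]
    consults only finitely many values of [T]. By compactness, inclusion in an open set is also
    settled at a finite level. *)
Lemma continuous_tree_hyperK : continuous (fun z => tree_hyperK (T z)).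
Proof.
apply: continuous_hyperK => O z oO /=.
  move=> KO; have [n Hn] := compact_prefix (@compact_tree_body R (T z)) oO KO.
  have := near_run_all z n; apply: filterS => y Ey x Kx.
  have : 0 < dens (run R (T z) (restr x n)) by rewrite -Ey ?size_restr.
  move=> /(body_meets (@decided_run R (T z)))[x' Kx' /cylE]; rewrite size_restr => xx'.
  by apply: (Hn x').
move=> [x [Kx Ox]].
have [n Hn] : exists n, forall y, restr y n = restr x n -> O y.
  by apply: nbhs_restr; exact: open_nbhs_nbhs.
have := near_run z (restr x n); apply: filterS => y Ey.
have : 0 < dens (run R (T y) (restr x n)) by rewrite Ey.
move=> /(body_meets (@decided_run R (T y)))[x' Kx' /cylE]; rewrite size_restr => xx'.
by exists x'; split => //; exact: Hn.
Qed.
End Continuity.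

(** * Tree representations and perfect subsets *)

Lemma clopen_near (X : topologicalType) (b : X -> bool) :
  (forall x, \forall y \near x, b y = b x) -> clopen [set x | b x].
Proof.
move=> H; split.
  by rewrite openE => x /= bx; have := H x; apply: filterS => y /= ->.
rewrite -[X in closed X]setCK; apply: open_closedC; rewrite openE => x /= bx.
by have := H x; apply: filterS => y /= ->.
Qed.

Lemma near_clopen (X : topologicalType) (W : set X) x : clopen W ->
  \forall y \near x, `[< W y >] = `[< W x >].
Proof.
move=> [oW cW]; have [Wx|nWx] := pselect (W x).
  have : nbhs x W by exact: open_nbhs_nbhs.
  by apply: filterS => y Wy; rewrite !asboolT.
have : nbhs x (~` W) by apply: open_nbhs_nbhs; split => //; exact: closed_openC.
by apply: filterS => y Wy; rewrite !asboolF.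
Qed.

Lemma pre_eq (v w : baire) n : pre v n = pre w n <-> forall i, (i < n)%N -> v i = w i.
Proof.
elim: n => [|n IH] //=; split=> [[E /IH H] i|H].
  by rewrite ltnS leq_eqVlt => /predU1P[->|/H].
by rewrite H // (IH.2 _) // => i ni; apply: H; exact: ltnW.
Qed.

Lemma pre_le (v w : baire) m n : (m <= n)%N -> pre v n = pre w n -> pre v m = pre w m.
Proof. by move=> mn /pre_eq H; apply/pre_eq => i im; apply: H; exact: leq_trans mn. Qed.

Lemma polish_base (R : realType) (Z : topologicalType) : polish R Z ->
  exists B : nat -> set Z, forall z O, open O -> O z -> exists2 k, B k z & B k `<=` O.
Proof.
move=> [d [d0 [dxx [dC [dT [dO [_ [D [cD DD]]]]]]]]].
have /countable_injP[f finj] := cD.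
pose B k := [set y | exists a n x, [/\ unpickle k = Some (a, n) :> option (nat * nat),
  D x, f x = a & d x y < n.+1%:R^-1]].
exists B => z O oO Oz; have [e e0 eO] := (dO O).1 oO z Oz.
(* A ball of radius below [e / 2] that contains [z] lies within distance [e] of [z]. *)
have [n nE] := ltr_add_invr (y := 0) (x := e / 2) (divr_gt0 e0 (ltr0n _ 2)).
rewrite add0r in nE.
have r0 : 0 < n.+1%:R^-1 :> R by rewrite invr_gt0 ltr0n.
pose q : R := n.+1%:R^-1.
have : nbhs z [set y | d z y < q].
  apply: open_nbhs_nbhs; split; last by rewrite /= (dxx z z).2.
  apply/dO => x /= zx; exists (q - d z x); first by rewrite subr_gt0.
  by move=> y /= xy; apply: le_lt_trans (dT _ x _) _; rewrite -ltrBrDl.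
have Dz : closure D z by rewrite DD.
move=> /Dz[x [Dx /= zx]]; exists (pickle (f x, n)).
  by exists (f x), n, x; split; rewrite ?pickleK // dC.
move=> y [a [m [x' []]]]; rewrite pickleK => -[<- <-] Dx' fx xy; apply: eO => /=.
have E : x' = x by apply: finj; rewrite ?inE.
rewrite E -/q in xy; rewrite -/q in nE; apply: le_lt_trans (dT _ x _) _; lra.
Qed.

(** For each string [s] and basic set [B k], fix a clopen [W (s, k)] over which no branch through
    [s] is in [C], containing [B k] whenever this is possible. [T z s] tests only the first [size s]
    of these sets, so it is locally constant in [z]. A pair outside [C] has a box missing [C], whose
    first side shrinks to a clopen set, and so it is rejected at some level. *)
Lemma tree_repr (R : realType) (Z : topologicalType) (C : set (Z * baire)) :
  polish R Z -> zero_dim Z -> closed C ->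
  exists T : Z -> seq nat -> bool,
    (forall z s, \forall y \near z, T y s = T z s) /\
    (forall z w, C (z, w) <-> forall n, T z (pre w n.+1)).
Proof.
move=> /polish_base[B HB] zZ cC.
pose avoids (W : set Z) s := forall z w, W z -> pre w (size s) = s -> ~ C (z, w).
have /choice[W HW] (p : seq nat * nat) : exists W : set Z, [/\ clopen W, avoids W p.1 &
    (exists W', [/\ clopen W', B p.2 `<=` W' & avoids W' p.1]) -> B p.2 `<=` W].
  have [[W' [cW' BW' aW']]|nW] := pselect (exists W', [/\ clopen W', B p.2 `<=` W' & avoids W' p.1]).
    by exists W'.
  by exists set0; split => //; exact: clopen0.
pose T z s := all (fun k => ~~ `[< W (s, k) z >]) (iota 0 (size s)).
exists T; split=> [z s|z w].
  rewrite /T; elim: (iota _ _) => [|k l IH]; first exact: nearW.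
  have [cW _ _] := HW (s, k); have := near_clopen z cW.
  by apply: filterS2 IH => y /= -> ->.
split=> [Czw n|Tw].
  apply/allP => k _; apply/asboolPn => Wz; have [_ a _] := HW (pre w n.+1, k).
  by apply: (a z w) => //=; rewrite size_pre.
apply: contrapT => nC.
have : nbhs (z, w) (~` C) by apply: open_nbhs_nbhs; split => //; exact: closed_openC.
move=> [[U V] /= [Uz /nbhs_pre[m Vm]] UV].
have [||W' [cW' W'z W'U]] := zZ z U°; [exact: open_interior|exact: Uz|].
have [k Bkz BkW] := HB z W' cW'.1 W'z.
(* The prefix of length [N.+1] is long enough to force [V] and to have test [k] performed. *)
pose N := maxn m k; have := Tw N; apply/negP; rewrite -has_predC; apply/hasP; exists k.
  by rewrite mem_iota size_pre /= add0n ltnS leq_maxr.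
rewrite /= negbK; apply/asboolP.
have [_ _ bW] := HW (pre w N.+1, k); apply: bW => //; exists W'; split => // z' v W'z'.
rewrite size_pre => /(pre_le (leqW (leq_maxl m k))) Ev.
apply: (UV (z', v)); split => /=; last exact: Vm.
by apply: interior_subset; exact: W'U.
Qed.

Definition halve (w : baire) : baire := fun i => (w i)./2.

Lemma continuous_halve : continuous halve.
Proof.
apply: (@continuous_coord nat) => i x; have := near_digit x i.
by apply: filterS => y; rewrite /halve => ->.
Qed.

Section Coding.
Variable R : realType.

(** A single [w] holds both data: its parities code the real and its halves the analytic witness. *)
Lemma Sigma11_phi (X : topologicalType) (A : set (X * R)) : Sigma11 A ->
  exists2 C : set (X * baire), closed C &
    forall x r, 0 <= r <= 1 -> A (x, r) <-> exists2 w, C (x, w) & phi R w = r.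
Proof.
move=> [C [cC ->]].
exists ((fun p : X * baire => ((p.1, phi R p.2), halve p.2)) @^-1` C).
  apply: closed_pre => //; apply: cont_pair; last by apply: cont_comp; [exact: continuous_halve|exact: cont_snd].
  apply: cont_pair; first exact: cont_fst.
  by apply: cont_comp; [exact: phi_continuous|exact: cont_snd].
move=> x r r01; split=> [[[p y] Cy /= Ep]|[w Cw <-]]; last by eexists; [exact: Cw|].
by have [w wr wy] := phi_onto y r01; exists w => //; rewrite /preimage /= wr /halve wy -Ep.
Qed.

Lemma Sigma11_phi_real (A : set R) : Sigma11 A ->
  exists2 E : set baire, closed E &
    forall r, 0 <= r <= 1 -> A r <-> exists2 w, E w & phi R w = r.
Proof.
move=> sA; have [C cC AC] := Sigma11_phi (preimage_Sigma11 (@cont_snd baire R) sA).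
exists [set w : baire | C ((fun=> 0%N) : baire, w)].
  by apply: (@closed_pre baire _ (fun w => ((fun=> 0%N) : baire, w))) cC;
    apply: cont_pair => w; [exact: cvg_cst|exact: cvg_id].
by move=> r r01; exact: AC.
Qed.

(** The perfect set theorem for analytic sets. A node is big when the branches of [E] through it
    have uncountably many [phi] values. Every big node has two big extensions with disjoint [phi]
    images, and iterating this gives a Cantor scheme. *)
Lemma perfect_embedding (S : set R) : S `<=` [set r | 0 <= r <= 1] -> Sigma11 S ->
  ~ countable S ->
  exists h : cantor_space -> R, [/\ continuous h, injective h & forall x, S (h x)].
Proof.
move=> S01 sS ncS.
have [E cE SC] := Sigma11_phi_real sS.
have SE r : S r <-> exists2 w, E w & phi R w = r.
  split=> [Sr|[w Ew <-]]; first exact/(SC _ (S01 _ Sr)).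
  by apply/SC; [exact: phi01|exists w].
pose on s := [set w : baire | E w /\ pre w (size s) = s].
pose big s := ~ countable (phi R @` on s).
have big0 : big [::].
  move=> c; apply: ncS; apply: sub_countable c; apply: subset_card_le.
  by move=> r /SE[w Ew <-]; exists w.
have splits s : exists t : bool -> seq nat, big s -> forall b,
    [/\ big (t b), (size s < size (t b))%N,
     forall w, pre w (size (t b)) = t b -> pre w (size s) = s &
     forall w w', pre w (size (t b)) = t b -> pre w' (size (t (~~ b))) = t (~~ b) ->
       phi R w <> phi R w'].
  have [bs|?] := pselect (big s); last by exists (fun=> [::]).
  (* All values contributed by small nodes form a countable set; a branch of [E] with value outside
     it has only big prefixes. *)
  pose bad := \bigcup_(t in [set t | ~ big t]) (phi R @` on t).
  have cbad : countable bad.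
    by apply: bigcup_countable => [|t /contrapT]; first exact: countableP.
  have [w0 [w1 [[on0 b0] [on1 b1] n01]]] : exists w0 w1,
      [/\ on s w0 /\ ~ bad (phi R w0), on s w1 /\ ~ bad (phi R w1) & phi R w0 <> phi R w1].
    apply: contrapT => H; apply: bs.
    have [[w ow nb]|nw] := pselect (exists2 w, on s w & ~ bad (phi R w)).
      apply: (@sub_countable _ _ _ (\bigcup_(b : bool) if b then bad else [set phi R w])); last first.
        by apply: bigcup_countable => [|[] _]; [exact: countableP|exact: cbad|exact: countable1].
      apply: subset_card_le => _ [v ov <-].
      have [?|nbv] := pselect (bad (phi R v)); [by exists true|exists false => //].
      by apply: contrapT => ne; apply: H; exists v, w.
    apply: sub_countable cbad; apply: subset_card_le => _ [v ov <-].
    by apply: contrapT => nbv; apply: nw; exists v.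
  have bigp w n : on s w -> ~ bad (phi R w) -> big (pre w n).
    move=> [Ew _] nb; apply: contrapT => nbig; apply: nb.
    by exists (pre w n) => //; exists w => //; rewrite /on /= size_pre.
  (* Branches sharing a prefix of length [n] have values within [2 * rad n], so a common value would
     force a distance of at most [4 * rad n]. *)
  have gap : 0 < `|phi R w0 - phi R w1| / 4.
    by rewrite divr_gt0 // normr_gt0 subr_eq0; apply/eqP.
  have [m hm] := rad_small gap; pose n := maxn m (size s).+1.
  have hn : rad R n < `|phi R w0 - phi R w1| / 4.
    by apply: le_lt_trans hm; apply: rad_le; exact: leq_maxl.
  have sn : (size s < n)%N by exact: leq_maxr.
  have far v0 v1 : pre v0 n = pre w0 n -> pre v1 n = pre w1 n -> phi R v0 <> phi R v1.
    move=> E0 E1 Ev; move: hn; apply/negP; rewrite -leNgt ler_pdivrMr //.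
    have := phi_near R v0 n; have := phi_near R v1 n.
    have := phi_near R w0 n; have := phi_near R w1 n; rewrite E0 E1 Ev !ler_norml.
    by move=> /andP[? ?] /andP[? ?] /andP[? ?] /andP[? ?]; apply/andP; split; lra.
  exists (fun b => if b then pre w0 n else pre w1 n) => _ b.
  case: b; rewrite /= !size_pre; split => //; try exact: bigp.
  - by move=> w /(pre_le (ltnW sn)) ->; exact: on0.2.
  - by move=> w /(pre_le (ltnW sn)) ->; exact: on1.2.
  - by move=> w w' Ew Ew' /esym; exact: far.
have /choice[g Hg] := splits.
pose f := fix f (x : cantor_space) n := if n is m.+1 then g (f x m) (x m) else [::].
have fbig x n : big (f x n) by elim: n => //= n /Hg /(_ (x n)) [].
have fsize x n : (n <= size (f x n))%N.
  by elim: n => //= n IH; apply: leq_ltn_trans IH _; have [] := Hg _ (fbig x n) (x n).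
have fext x m n w : (m <= n)%N -> pre w (size (f x n)) = f x n -> pre w (size (f x m)) = f x m.
  move=> /subnKC <-; elim: (_ - _)%N => [|k IH]; first by rewrite addn0.
  by rewrite addnS /= => H; apply: IH; have [_ _ h _] := Hg _ (fbig x (m + k)%N) (x (m + k)%N); exact: h.
have /choice[v Hv] s : exists w, big s -> on s w.
  have [[w ?]|nw] := pselect (exists w, on s w); first by exists w.
  exists (fun=> 0%N) => bs; exfalso; apply: bs.
  apply: (@sub_countable _ _ _ set0); last exact: countable0.
  by apply: subset_card_le => r [w ow _]; case: nw; exists w.
(* [f x i.+1] has more than [i] entries, so entry [i] is the same for every branch through it. *)
pose W (x : cantor_space) : baire := fun i => v (f x i.+1) i.
have pW x n : pre (W x) (size (f x n)) = f x n.
  have [_ <-] := Hv _ (fbig x n); rewrite size_pre; apply/pre_eq => i ni.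
  pose M := maxn i.+1 n; have [_ vM] := Hv _ (fbig x M).
  have e1 := fext x i.+1 M _ (leq_maxl _ _) vM; have e2 := fext x n M _ (leq_maxr _ _) vM.
  have [_ e3] := Hv _ (fbig x i.+1); have [_ e4] := Hv _ (fbig x n).
  have := (pre_eq _ _ _).1 (etrans e3 (esym e1)) i (fsize x i.+1).
  have := (pre_eq _ _ _).1 (etrans e4 (esym e2)) i ni.
  by rewrite /W => -> ->.
have EW x : E (W x).
  apply: contrapT => nE.
  have : nbhs (W x) (~` E) by apply: open_nbhs_nbhs; split => //; exact: closed_openC.
  move=> /nbhs_pre[n Hn]; have [Ev ev] := Hv _ (fbig x n); apply: (Hn (v (f x n))) => //.
  by apply: (pre_le (fsize x n)); rewrite ev pW.
exists (fun x => phi R (W x)); split; last by move=> x; apply/SE; exists (W x).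
  apply: cont_comp; first exact: phi_continuous.
  apply: (@continuous_coord nat) => i x.
  have : \forall y \near x, restr y i.+1 = restr x i.+1 by exact: near_restr.
  apply: filterS => y Exy; rewrite /W; congr v.
  elim: i.+1 Exy => [//|n IH] /=; rewrite !restrS => /rcons_inj[Exy ->].
  by rewrite IH.
move=> x y hxy.
suff H n : f x n = f y n /\ forall i, (i < n)%N -> x i = y i.
  by apply/funext => i; apply: (H i.+1).2.
elim: n => [|n [fE IH]]; first by [].
(* At a first differing bit the two sequences pass to the two separated extensions of one node,
   contradicting equal values. *)
have xyn : x n = y n.
  apply/eqP; rewrite -[_ == _]negbK -eqbF_neg; apply/negP => ne.
  have {}ne : y n = ~~ x n by move: ne; case: (x n); case: (y n).
  have [_ _ _ h] := Hg _ (fbig x n) (x n); apply: (h _ _ (pW x n.+1) _ hxy).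
  by have := pW y n.+1; rewrite /= -fE ne.
split; first by rewrite /= fE xyn.
by move=> i; rewrite ltnS leq_eqVlt => /predU1P[->//|]; exact: IH.
Qed.
End Coding.

(** * Hardness *)

(** The characteristic function of the graph of [y]: a coding of Baire space inside the compact
    Cantor space. *)
Definition graph_code (x : cantor_space) (y : baire) :=
  forall i j : nat, x (pickle (i, j)) = (y i == j).

Lemma graph_code_ex y : exists x, graph_code x y.
Proof.
exists (fun n => if unpickle n is Some p then y (p : nat * nat).1 == p.2 else false).
by move=> i j; rewrite pickleK.
Qed.

Lemma graph_code_inj x y y' : graph_code x y -> graph_code x y' -> y = y'.
Proof.
move=> h h'; apply/funext => i; apply/esym/eqP.
by rewrite -h' h eqxx.
Qed.

Lemma graph_codeP x : (exists y, graph_code x y) <->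
  (forall i : nat, exists j : nat, x (pickle (i, j))) /\
  (forall i j k : nat, x (pickle (i, j)) -> x (pickle (i, k)) -> j = k).
Proof.
split=> [[y xy]|[H1 H2]].
  by split=> [i|i j k]; [exists (y i)|]; rewrite !xy // => /eqP -> /eqP ->.
have [y Hy] := choice H1; exists y => i j; apply/idP/eqP => [xj|<-//].
exact: H2 (Hy i) xj.
Qed.

Lemma Sigma11_not_graph_code : Sigma11 [set x | ~ exists y, graph_code x y].
Proof.
have D n (b : bool) : Delta11 [set x : cantor_space | x n = b].
  apply: clopen_Delta11; rewrite (_ : [set _ | _] = [set x : cantor_space | x n == b]).
    by apply: clopen_near => x; have := near_bits x n; apply: filterS => y ->.
  by rewrite eqEsubset; split=> x /= => [->|/eqP].
rewrite (_ : [set _ | _] = (\bigcup_(i : nat) \bigcap_(j : nat) [set x | x (pickle (i, j)) = false]) `|`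
   \bigcup_(p : nat * nat * nat) ([set x | x (pickle (p.1.1, p.1.2)) = true] `&`
       ([set x | x (pickle (p.1.1, p.2)) = true] `&` [set _ | p.1.2 <> p.2]))).
  apply: setU_Sigma11.
    by apply: bigcup_Sigma11 => i; apply: bigcap_Sigma11 => j; exact: (D _ _).1.
  apply: bigcup_Sigma11 => p; apply: setI_Sigma11; first exact: (D _ _).1.
  by apply: setI_Sigma11; [exact: (D _ _).1|exact: (cst_Delta11 _ _).1].
rewrite eqEsubset; split=> [x /= H|x [[i _ xi]|[[[i j] k] _ /= [xj [xk jk]]]] /graph_codeP[H1 H2]].
- apply: contrapT => /not_orP[n1 n2]; apply: H; apply/graph_codeP; split.
    move=> i; apply: contrapT => /forallNP xi; apply: n1; exists i => // j _.
    by apply/negbTE/negP; exact: xi.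
  move=> i j k xj xk; apply: contrapT => jk; apply: n2; exists (i, j, k) => //.
- by have [j] := H1 i; rewrite (xi j).
- by apply: jk; exact: H2 xj xk.
Qed.

(** A continuous surjection, turning quantifiers over the Cantor space into quantifiers over
    [baire]. *)
Definition to_cantor (y : baire) : cantor_space := fun i => y i != 0%N.

Lemma to_cantor_continuous : continuous to_cantor.
Proof.
apply: (@continuous_coord bool) => i x; have := near_digit x i.
by apply: filterS => y; rewrite /to_cantor => ->.
Qed.

Lemma to_cantor_onto x : exists y, to_cantor y = x.
Proof. by exists (fun i => x i : nat); apply/funext => i; rewrite /to_cantor eqb0 negbK. Qed.

Section Hardness.
Variables (R : realType) (S : set R).
Hypotheses (S01 : S `<=` `]0, 1[%classic) (sS : Sigma11 S) (uS : ~ countable S).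

Lemma S_itv r : S r -> 0 < r < 1.
Proof. by move=> /S01; rewrite /= in_itv. Qed.

Lemma closed_eq_real (X : topologicalType) (f g : X -> R) :
  continuous f -> continuous g -> closed [set x | f x = g x].
Proof.
move=> cf cg; rewrite (_ : [set _ | _] = (fun x => f x - g x) @^-1` [set 0]).
  apply: closed_pre => [x|]; last exact: closed_eq.
  by apply: cvgB; [exact: cf|exact: cg].
by rewrite eqEsubset; split=> x /= => [->|/eqP]; rewrite ?subrr // subr_eq0 => /eqP.
Qed.

(* A3 lists the codes of the y with D(z, y), where D is the complement of C;
   A1 and A2 add every point of S that is not a code. *)
Lemma section_coding (Z : topologicalType) (B : set Z) : Pi12 B ->
  exists A : set (Z * R), [/\ Sigma11 A, forall z r, A (z, r) -> S r &
    forall z, B z <-> forall r, S r -> A (z, r)].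
Proof.
move=> [C [pC BC]].
have [h [ch ih Sh]] : exists h : cantor_space -> R,
    [/\ continuous h, injective h & forall x, S (h x)].
  by apply: perfect_embedding => // r /S_itv /= /andP[? ?]; rewrite !ltW.
have c_even : continuous (reindex double) := @cont_reindex _.
have c_odd : continuous (reindex (fun n => n.*2.+1)) := @cont_reindex _.
pose A1 : set (Z * R) := snd @^-1` (S `&` ~` range h).
pose A2 : set (Z * R) := fst @` [set p : (Z * R) * baire |
  p.1.2 = h (to_cantor p.2) /\ ~ exists y, graph_code (to_cantor p.2) y].
pose A3 : set (Z * R) := fst @` ([set p : (Z * R) * baire |
    p.1.2 = h (to_cantor (reindex double p.2))] `&`
  ([set p | graph_code (to_cantor (reindex double p.2)) (reindex (fun n => n.*2.+1) p.2)] `&`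
   [set p | ~ C (p.1.1, reindex (fun n => n.*2.+1) p.2)])).
have cp2 : continuous (fun p : (Z * R) * baire => p.1.2).
  by apply: cont_comp; [exact: cont_snd|exact: cont_fst].
have cp1 : continuous (fun p : (Z * R) * baire => p.1.1).
  by apply: cont_comp; [exact: cont_fst|exact: cont_fst].
have cev : continuous (fun p : (Z * R) * baire => to_cantor (reindex double p.2)).
  apply: cont_comp; first exact: to_cantor_continuous.
  by apply: cont_comp; [exact: c_even|exact: cont_snd].
have cod : continuous (fun p : (Z * R) * baire => reindex (fun n => n.*2.+1) p.2).
  by apply: cont_comp; [exact: c_odd|exact: cont_snd].
have s1 : Sigma11 A1.
  apply: preimage_Sigma11; first exact: cont_snd.
  apply: setI_Sigma11 => //; apply: (closed_real_Delta11 _).2.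
  (* The range of [h] is compact, hence closed, so its complement is analytic. *)
  apply: compact_closed; first exact: norm_hausdorff.
  apply: continuous_compact; last exact: cantor_space_compact.
  exact: continuous_subspaceT.
have s2 : Sigma11 A2.
  apply: proj_Sigma11; apply: setI_Sigma11.
    apply: closed_Sigma11; apply: closed_eq_real => //.
    by apply: cont_comp => //; apply: cont_comp; [exact: to_cantor_continuous|exact: cont_snd].
  apply: (preimage_Sigma11 (f := fun p : (Z * R) * baire => to_cantor p.2) _ Sigma11_not_graph_code).
    by apply: cont_comp; [exact: to_cantor_continuous|exact: cont_snd].
have s3 : Sigma11 A3.
  apply: proj_Sigma11; apply: setI_Sigma11; last apply: setI_Sigma11.
  - by apply: closed_Sigma11; apply: closed_eq_real => //; exact: cont_comp.
  - pose b (ij : nat * nat) (p : (Z * R) * baire) :=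
      to_cantor (reindex double p.2) (pickle ij) == (reindex (fun n => n.*2.+1) p.2 ij.1 == ij.2).
    have nb ij p : \forall q \near p, b ij q = b ij p.
      have h1 := cev p _ (near_bits _ (pickle ij)); have h2 := cod p _ (near_digit _ ij.1).
      by apply: filterS2 (h1 : nbhs p _) (h2 : nbhs p _) => q /= e1 e2; rewrite /b e1 e2.
    rewrite (_ : [set _ | _] = \bigcap_(ij : nat * nat) [set p | b ij p]).
      by apply: bigcap_Sigma11 => ij; have [_ cb] := clopen_near (nb ij); exact: closed_Sigma11.
    rewrite eqEsubset; split=> [p H [i j] _|p H i j]; first by apply/eqP; exact: H.
    by have /eqP := H (i, j) Logic.I.
  - apply: (preimage_Sigma11 (f := fun p : (Z * R) * baire => (p.1.1, reindex (fun n => n.*2.+1) p.2)) _ pC).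
    exact: cont_pair.
exists (A1 `|` (A2 `|` A3)); split.
- by apply: setU_Sigma11 => //; exact: setU_Sigma11.
- move=> z r [[]//|[[[[z' r'] u] [/= E _] [_ <-]]|[[[z' r'] u] [/= E _] [_ <-]]]]; rewrite E; exact: Sh.
move=> z; split=> [Bz r Sr|H].
  have [[x _ xr]|nr] := pselect (range h r); last by left.
  right; have [[y xy]|nx] := pselect (exists y, graph_code x y); last first.
    by left; have [u ux] := to_cantor_onto x; exists (z, r, u) => //=; rewrite ux.
  right; have [v vx] := to_cantor_onto x.
  pose u : baire := fun n => if odd n then y n./2 else v n./2.
  have ue : reindex double u = v.
    by apply/funext => n; rewrite /reindex /u odd_double doubleK.
  have uo : reindex (fun n => n.*2.+1) u = y.
    by apply/funext => n; rewrite /reindex /u /= odd_double /= uphalf_double.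
  exists (z, r, u) => //=; rewrite ue uo vx; split => //; split => // Czy.
  have : (~` B) z by rewrite BC; exists (z, y).
  exact.
apply: contrapT => nB; have : (~` B) z by [].
rewrite BC => -[[z' y] /= Czy Ez]; subst z'.
(* The value [h x] escapes all three parts: it is in the range of [h], [x] is a code, and by
   injectivity a witness for [A3] would have to name this same [y]. *)
have [x xy] := graph_code_ex y.
have [[_ nr]|[[[[z' r'] u] [/= E1 E2] [_ E3]]|[[[z' r'] u] [/= E1 [E2 E4]] [Ez E3]]]] := H (h x) (Sh x).
- by apply: nr; exists x.
- by rewrite E3 in E1; apply: E2; exists y; rewrite -(ih _ _ E1).
- rewrite E3 in E1; have Ex := ih _ _ E1; rewrite -Ex in E2.
  by apply: E4; rewrite -(graph_code_inj xy E2) /= Ez.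
Qed.

(** The body built from [T z] has range [{0, 1}] together with the section of [A] at [z]. As [S]
    avoids 0 and 1, the range is the required one exactly when that section is all of [S]. *)
Lemma range_reduction (Z : topologicalType) (B : set Z) :
  polish R Z -> zero_dim Z -> Pi12 B ->
  exists f : Z -> hyperK, continuous f /\
    B = f @^-1` [set K : hyperK | density_range (R := R) (proj1_sig K) = [set 0; 1] `|` S].
Proof.
move=> pZ zZ /section_coding[A [sA AS BA]].
have [C cC AC] := Sigma11_phi sA.
have [T [Tn TC]] := tree_repr pZ zZ cC.
exists (fun z => tree_hyperK R (T z)); split; first exact: continuous_tree_hyperK.
have rE z : density_range (tree_body R (T z)) = [set 0; 1] `|` [set r | A (z, r)].
  rewrite density_range_tree_body; congr setU; rewrite eqEsubset; split=> [_ [w Tw <-]|r Ar].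
    by apply/AC; [exact: phi01|exists w => //; exact/TC].
  have /S_itv/andP[/ltW r0 /ltW r1] := AS _ _ Ar.
  have [||w Cw wr] := (AC z r _).1 => //; first by rewrite r0.
  by exists w => //; exact/TC.
rewrite eqEsubset; split=> z /=; rewrite rE.
  move=> /BA SA; congr setU; rewrite eqEsubset; split=> r /=; [exact: AS|exact: SA].
move=> E; apply/BA => r Sr; have : ([set 0; 1] `|` S) r by right.
rewrite -E => -[[r0|r1]|//]; have := S_itv Sr; rewrite ?r0 ?r1 ?ltxx ?andbF //.
Qed.
End Hardness.

(** * The upper bound *)

Section UpperBound.
Variable R : realType.

Lemma clopen_cylcover l : clopen (cylcover l).
Proof.
elim: l => [|s l IH].
  by rewrite (_ : cylcover _ = set0); [exact: clopen0|rewrite eqEsubset; split=> x // []].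
rewrite (_ : cylcover _ = cyl s `|` cylcover l); first exact: clopenU (clopen_cyl s) IH.
rewrite eqEsubset; split=> x.
  by move=> [t]; rewrite inE => /predU1P[->|tl] tx; [left|right; exists t].
by move=> [sx|[t tl tx]]; [exists s|exists t => //]; rewrite ?inE ?eqxx ?tl ?orbT.
Qed.

Lemma coin_mu_cyl_le (A : set cantor_space) u : (coin_mu R (A `&` cyl u) <= (weight R u)%:E)%E.
Proof.
apply: le_trans (_ : _ <= (cost R [:: u])%:E)%E _; last by rewrite /cost big_seq1.
by apply: coin_mu_cover => x [_ ux]; exists u; rewrite ?mem_seq1.
Qed.

Lemma coin_mu_fin (A : set cantor_space) u : coin_mu R (A `&` cyl u) \is a fin_num.
Proof.
by rewrite ge0_fin_numE ?coin_mu_ge0 //; apply: le_lt_trans (coin_mu_cyl_le A u) _; rewrite ltry.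
Qed.

(** By compactness finitely many cylinders of a cheap cover suffice, which leaves a quantifier over
    the countable set of finite lists. *)
Lemma coin_mu_lt (K : set cantor_space) u (c : R) : compact K ->
  fine (coin_mu R (K `&` cyl u)) < c <->
  exists2 l, K `&` cyl u `<=` cylcover l & cost R l < c.
Proof.
move=> cK; have fin := coin_mu_fin K u.
split=> [|[l Kl lc]]; last first.
  apply: le_lt_trans lc; rewrite -lee_fin fineK //; exact: coin_mu_cover.
rewrite -lte_fin fineK // => /ereal_inf_lt[_ [s [Ks ->]] sc].
have cKu : compact (K `&` cyl u) by apply: compact_closedI => //; exact: (clopen_cyl u).2.
move: cKu; rewrite compact_cover => /(_ nat setT (fun n => cyl (s n)))[||D _ KD].
- by move=> n _; exact: (clopen_cyl _).1.
- by move=> x /Ks[n _ nx]; exists n.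
have [N HN] : exists N : nat, forall n : nat, n \in finmap.enum_fset D -> (n < N)%N.
  by exists (\max_(n <- finmap.enum_fset D) n).+1 => n nD; rewrite ltnS; exact: leq_bigmax_seq.
exists [seq s n | n <- iota 0 N].
  move=> x /KD[n /= nD nx]; exists (s n) => //; apply: map_f.
  by rewrite mem_iota /= add0n HN.
rewrite -lte_fin; apply: le_lt_trans sc; rewrite /cost big_map -sumEFin.
apply: le_trans (@nneseries_lim_ge _ _ xpredT 0 N _); last first.
  by move=> n _ _; rewrite lee_fin ltW // weight_gt0.
by rewrite /index_iota subn0.
Qed.

Lemma density_seq01 (A : set cantor_space) z n : 0 <= density_seq R A z n <= 1.
Proof.
have w0 := weight_gt0 R (restr z n); have e : weight R (restr z n) = 2%:R ^- n by rewrite /weight size_restr.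
rewrite /density_seq -e; apply/andP; split.
  by rewrite divr_ge0 ?fine_ge0 ?coin_mu_ge0 // ltW.
by rewrite ler_pdivrMr // mul1r -lee_fin fineK ?coin_mu_fin // coin_mu_cyl_le.
Qed.

Lemma density_range01 (A : set cantor_space) : density_range A `<=` [set r : R | 0 <= r <= 1].
Proof.
move=> r [z cr]; have b n := density_seq01 A z n.
rewrite /= -(cvg_lim (@norm_hausdorff _ R) cr); apply/andP; split.
  by apply: limr_ge; [apply/cvg_ex; exists r|apply: nearW => n; case/andP: (b n)].
by apply: limr_le; [apply/cvg_ex; exists r|apply: nearW => n; case/andP: (b n)].
Qed.

Lemma Delta11_density_lt n (c : R) :
  Delta11 [set p : hyperK * cantor_space | density_seq R (proj1_sig p.1) p.2 n < c].
Proof.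
rewrite (_ : [set _ | _] = \bigcup_(l : seq (seq bool)) \bigcup_(u : seq bool)
   ([set p | restr p.2 n = u] `&` ([set p | proj1_sig p.1 `<=` ~` cyl u `|` cylcover l] `&`
    [set _ | cost R l < c * 2%:R ^- n])) :> set (hyperK * cantor_space)).
  apply: bigcup_Delta11 => l; apply: bigcup_Delta11 => u; apply: setI_Delta11; last apply: setI_Delta11.
  - apply: (@preimage_Delta11 _ cantor_space snd [set z | restr z n = u]); first exact: cont_snd.
    exact/clopen_Delta11/(clopen_restr n (fun v => v = u)).
  - apply: (@preimage_Delta11 _ hyperK fst [set K : hyperK | proj1_sig K `<=` ~` cyl u `|` cylcover l]).
      exact: cont_fst.
    apply/clopen_Delta11/clopen_sub; apply: clopenU; last exact: clopen_cylcover.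
    exact: (clopenC set0 (clopen_cyl u)).
  - exact: cst_Delta11.
have p2 : 0 < (2%:R : R) ^- n by rewrite invr_gt0 exprn_gt0.
rewrite eqEsubset; split=> [[[K cK] z]|[[K cK] z]] /=.
  rewrite /density_seq ltr_pdivrMr // => /(coin_mu_lt _ _ cK)[l Kl lc].
  exists l => //; exists (restr z n) => //; split => //; split => //= x Kx.
  by have [ux|nux] := pselect (cyl (restr z n) x); [right; exact: Kl|left].
move=> [l _ [u _ [/= zu [/= Kl lc]]]]; rewrite /density_seq ltr_pdivrMr //.
apply/(coin_mu_lt _ _ cK); exists l => // x [Kx]; rewrite zu => ux.
by have [] := Kl x Kx.
Qed.

(** Convergence is tested on rational cuts: the densities are eventually at least each [q] below the
    limit, and eventually less than each [q] above it. *)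
Lemma Delta11_density_at :
  Delta11 [set p : (hyperK * cantor_space) * R | density_at (proj1_sig p.1.1) p.1.2 p.2].
Proof.
pose lt q n := [set p : (hyperK * cantor_space) * R | density_seq R (proj1_sig p.1.1) p.1.2 n < ratr q].
have dlt q n : Delta11 (lt q n).
  exact: (preimage_Delta11 (@cont_fst _ _) (Delta11_density_lt n (ratr q))).
rewrite (_ : [set _ | _] = \bigcap_(q : rat)
   (([set p | p.2 <= ratr q] `|` \bigcup_(N : nat) \bigcap_(n : nat) ([set _ | (n < N)%N] `|` ~` lt q n)) `&`
    ([set p | ratr q <= p.2] `|` \bigcup_(N : nat) \bigcap_(n : nat) ([set _ | (n < N)%N] `|` lt q n)))).
  have ev (F : nat -> set ((hyperK * cantor_space) * R)) : (forall n, Delta11 (F n)) ->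
      Delta11 (\bigcup_(N : nat) \bigcap_(n : nat) ([set _ | (n < N)%N] `|` F n)).
    move=> dF; apply: bigcup_Delta11 => N; apply: bigcap_Delta11 => n.
    by apply: setU_Delta11 => //; exact: cst_Delta11.
  apply: bigcap_Delta11 => q; apply: setI_Delta11; apply: setU_Delta11.
  - apply: (@preimage_Delta11 _ R snd [set r | r <= ratr q]); first exact: cont_snd.
    exact/closed_real_Delta11/closed_le.
  - by apply: ev => n; exact: setC_Delta11.
  - apply: (@preimage_Delta11 _ R snd [set r | ratr q <= r]); first exact: cont_snd.
    exact/closed_real_Delta11/closed_ge.
  - exact: ev.
rewrite eqEsubset; split=> [[[K z] r] /= cr q _|[[K z] r] H] /=.
  split.
    have [|qr] := leP r (ratr q); [by left|right].
    have [N _ HN] := cvgr_gt _ cr _ qr; exists N => // n _ /=.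
    by have [|Nn] := ltnP n N; [left|right; rewrite /lt /= ltNge; apply/negP; rewrite negbK; apply/ltW/HN].
  have [|qr] := leP (ratr q) r; [by left|right].
  have [N _ HN] := cvgr_lt _ cr _ qr; exists N => // n _ /=.
  by have [|Nn] := ltnP n N; [left|right; exact: HN].
apply/cvgrPdist_lt => e e0.
have [q] := @rat_in_itvoo R r (r + e) (ltr_pwDr e0 (lexx r)); rewrite in_itv /= => /andP[q1 q2].
have [|q'] := @rat_in_itvoo R (r - e) r; first by rewrite ltrBlDr ltrDl.
rewrite in_itv /= => /andP[q3 q4].
have [_ [q5|[N1 _ H1]]] := H q Logic.I; first by have := lt_le_trans q1 q5; rewrite ltxx.
have [[q5|[N2 _ H2]] _] := H q' Logic.I; first by have := lt_le_trans q4 q5; rewrite ltxx.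
exists (maxn N1 N2) => // n /=; rewrite geq_max => /andP[n1 n2].
have [/=|] := H1 n Logic.I; first by rewrite ltnNge n1.
have [/=|] := H2 n Logic.I; first by rewrite ltnNge n2.
rewrite /lt /= => /negP; rewrite -leNgt => h1 h2.
by rewrite ltr_norml; apply/andP; split; lra.
Qed.

Variable S : set R.
Hypotheses (S01 : S `<=` `]0, 1[%classic) (sS : Sigma11 S).

(** The range is wrong when some value outside [TT] is attained ([C1]) or some value of [TT] is not
    ([C2]). In both, [w] codes the real by parities; its halves code the point in [C1], and in [C2]
    the closed condition [E] certifies membership in [TT]. Since the density relation and its
    complement are analytic, both sets are coanalytic. *)
Lemma Pi12_range : Pi12 [set K : hyperK | density_range (R := R) (proj1_sig K) = [set 0; 1] `|` S].
Proof.
pose TT := [set 0; 1] `|` S.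
have TT01 r : TT r -> 0 <= r <= 1.
  by move=> [[->|->]|/(S_itv S01)/andP[/ltW -> /ltW ->]]; rewrite ?lexx ?ler01.
have sT : Sigma11 TT.
  apply: setU_Sigma11 => //; apply: closed_Sigma11; apply: closedU; exact: closed_eq.
have [E cE TC] := Sigma11_phi_real sT.
pose at_ (K : hyperK) x (r : R) := density_at (proj1_sig K) x r.
pose C1 := [set p : hyperK * baire |
  at_ p.1 (to_cantor (halve p.2)) (phi R p.2) /\ ~ TT (phi R p.2)].
pose C2 := [set p : hyperK * baire | E p.2 /\ forall x, ~ at_ p.1 x (phi R p.2)].
exists (C1 `|` C2); split.
  rewrite /Pi11 setCU; apply: setI_Sigma11.
    rewrite (_ : ~` C1 = [set p | ~ at_ p.1 (to_cantor (halve p.2)) (phi R p.2)] `|`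
        (fun p : hyperK * baire => phi R p.2) @^-1` TT).
      apply: setU_Sigma11; last first.
        apply: preimage_Sigma11 => //.
        by apply: cont_comp; [exact: phi_continuous|exact: cont_snd].
      apply: (@preimage_Sigma11 _ _ (fun p : hyperK * baire =>
        ((p.1, to_cantor (halve p.2)), phi R p.2)) _ _ Delta11_density_at.2).
      apply: cont_pair; last by apply: cont_comp; [exact: phi_continuous|exact: cont_snd].
      apply: cont_pair; first exact: cont_fst.
      apply: cont_comp; first exact: to_cantor_continuous.
      by apply: cont_comp; [exact: continuous_halve|exact: cont_snd].
    rewrite eqEsubset; split=> p /=.
      by move=> /not_andP[?|/contrapT ?]; [left|right].
    by move=> [na [? _]|t [_ nt]].
  rewrite (_ : ~` C2 = (snd @^-1` ~` E) `|` fst @` [set q : (hyperK * baire) * baire |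
      at_ q.1.1 (to_cantor q.2) (phi R q.1.2)]).
    apply: setU_Sigma11.
      by apply: preimage_Sigma11; [exact: cont_snd|exact: (closed_baire_Delta11 cE).2].
    apply: proj_Sigma11.
    apply: (@preimage_Sigma11 _ _ (fun q : (hyperK * baire) * baire =>
        ((q.1.1, to_cantor q.2), phi R q.1.2)) _ _ Delta11_density_at.1).
    apply: cont_pair.
      apply: cont_pair; first by apply: cont_comp; exact: cont_fst.
      by apply: cont_comp; [exact: to_cantor_continuous|exact: cont_snd].
    apply: cont_comp; first exact: phi_continuous.
    by apply: cont_comp; [exact: cont_snd|exact: cont_fst].
  rewrite eqEsubset; split=> [p /not_andP[nE|/existsNP[x /contrapT ax]]|p].
  - by left.
  - by right; have [u ux] := to_cantor_onto x; exists (p, u) => //=; rewrite ux.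
  - by move=> [nE [? _] //|[[p' u] /= a <-] [_ na]]; exact: na a.
rewrite eqEsubset; split=> [K /= nK|K].
  apply: contrapT => H; apply: nK; rewrite eqEsubset; split=> r.
    move=> [z az]; apply: contrapT => nT; apply: H.
    have [v vz] := to_cantor_onto z.
    have r01 : 0 <= r <= 1 by apply: (@density_range01 (proj1_sig K)); exists z.
    have [w wr wv] := phi_onto v r01.
    by exists (K, w) => //; left; rewrite /C1 /= wr; split => //; rewrite [halve w]wv vz.
  move=> Tr; apply: contrapT => nr; apply: H.
  have [w Ew wr] := (TC r (TT01 _ Tr)).1 Tr.
  by exists (K, w) => //; right; split => //= x ax; apply: nr; exists x; rewrite -wr.
move=> [[K' w] [[/= a nT]|[/= Ew na]] <-] /= Er.
  by apply: nT; rewrite /TT -Er; eexists; exact: a.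
have Tw : TT (phi R w) by apply/TC; [exact: phi01|exists w].
by move: Tw; rewrite /TT -Er => -[x]; exact: na.
Qed.

Lemma Pi12_complete_range : ~ countable S ->
  Pi12_complete R [set K : hyperK | density_range (R := R) (proj1_sig K) = [set 0; 1] `|` S].
Proof.
move=> uS; split; first exact: Pi12_range.
by move=> Z pZ zZ B BB; exact: range_reduction.
Qed.
End UpperBound.

Theorem theorem5p5 (R : realType) (S : set R) :
  S `<=` `]0, 1[%classic -> Sigma11 S -> ~ countable S ->
  Pi12_complete R [set K : hyperK | @density_range R (proj1_sig K) = [set 0; 1] `|` S] /\
  Pi12_complete R [set K : hyperK | @density_range R (proj1_sig K) = `[0, 1]%classic].
Proof.
move=> S01 sS uS; split; first exact: Pi12_complete_range.
(* The second claim is the first one for the open unit interval, which is analytic and, having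
   measure 1, uncountable. *)
have -> : `[0, 1]%classic = [set 0; 1] `|` `]0, 1[%classic :> set R.
  rewrite eqEsubset; split=> r; rewrite /= !in_itv /=.
    move=> /andP[]; rewrite le_eqVlt => /predU1P[<-|r0]; first by left; left.
    by rewrite le_eqVlt => /predU1P[->|r1]; [left; right|right; rewrite r0].
  by move=> [[->|->]|/andP[/ltW -> /ltW ->]]; rewrite ?lexx ?ler01.
apply: Pi12_complete_range => //.
  rewrite -[X in Sigma11 X]setCK; apply: (closed_real_Delta11 _).2.
  by apply: open_closedC; exact: interval_open.
move=> /countable_lebesgue_measure0; rewrite lebesgue_measure_itv /= lte_fin ltr01.
by rewrite sube0 => -[] /eqP; rewrite oner_eq0.
Qed.
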